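(* Let $\mathcal H_1,\mathcal H_2$ be Hilbert spaces, $A$ a self-adjoint operator in $\mathcal H_1$ bounded from below, $B$ a densely defined closable operator from $\mathcal H_2$ to $\mathcal H_1$, and $D$ a self-adjoint operator in $\mathcal H_2$ bounded from above; let $\mathfrak a$, $\mathfrak d$ be the closed quadratic forms associated with $A$, $D$. Assume that $\mathrm{dom}(\mathfrak a)\subset\mathrm{dom}(B^* )$ and that either (I) $\mathrm{dom}(B)\subset\mathrm{dom}(D)$ and $\mathrm{dom}(B)$ is a core for $D$, or (II) $\mathrm{dom}(\mathfrak d)\subset\mathrm{dom}(B)$. Let $\mathcal M$ be the closure of $\mathcal M_0=\begin{pmatrix}A&B\\-B^*&D\end{pmatrix}$ with $\mathrm{dom}(\mathcal M_0)=(\mathrm{dom}(A)\cap\mathrm{dom}(B^* ))\times(\mathrm{dom}(B)\cap\mathrm{dom}(D))$ in $\mathcal H_1\oplus\mathcal H_2$. Let $\delta_+=\max\sigma(D)$ and let $z\in\mathbb C\setminus(\delta_+,\delta_++b_0)$. Then $z\in\sigma(\mathcal M)$ implies $z\in\overline{W^2(\mathcal M)}$.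
   Context: Hilbert spaces are non-zero and complex; inner products are linear in the first argument. $\mathfrak a$ has domain $\mathrm{dom}(|A|^{1/2})$ and $\mathfrak d$ has domain $\mathrm{dom}(|D|^{1/2})$; $\mathfrak a[x]=\mathfrak a[x,x]$, $\mathfrak d[y]=\mathfrak d[y,y]$. Under the stated assumptions $\mathcal M_0$ is closable. The number $b_0$ is the infimum of all $b\ge0$ for which there is an $a\in\mathbb R$ with $\|B^*x\|^2\le a\|x\|^2+b\,\mathfrak a[x]$ for all $x\in\mathrm{dom}(\mathfrak a)$ (such $a,b$ exist). The quadratic numerical range $W^2(\mathcal M)$ is the set of all eigenvalues of all $2\times2$ matrices $$\mathcal M_{x,y}=\begin{pmatrix}\dfrac{\mathfrak a[x]}{\|x\|^2}&\dfrac{\langle y,B^*x\rangle}{\|x\|\,\|y\|}\\[2ex]-\dfrac{\langle B^*x,y\rangle}{\|x\|\,\|y\|}&\dfrac{\mathfrak d[y]}{\|y\|^2}\end{pmatrix},\qquad x\in\mathrm{dom}(\mathfrak a)\setminus\{0\},\ y\in\mathrm{dom}(\mathfrak d)\setminus\{0\}.$$ *)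

(* Defs.v *)
From mathcomp Require Import all_boot all_order all_algebra.
From mathcomp Require Import complex.
From mathcomp Require Import all_classical all_reals all_analysis.

Set Implicit Arguments.
Unset Strict Implicit.
Unset Printing Implicit Defensive.

Import Order.TTheory GRing.Theory Num.Theory.
Import numFieldNormedType.Exports.

Local Open Scope classical_set_scope.
Local Open Scope ring_scope.
Local Open Scope complex_scope.

(* The class {dot H for Num.conj} makes the inner product linear in its first
   and conjugate-linear in its second argument. *)
Record hilbertType (R : realType) := HilbertType {
  hilbert_sort :> completeNormedModType R[i];
  inner : {dot hilbert_sort for (@Num.conj R[i])};
  inner_norm : forall x : hilbert_sort, inner x x = `|x| ^+ 2;
  hilbert_nontrivial : exists x : hilbert_sort, x != 0 }.

Arguments inner {R h}.
Arguments inner_norm {R h}.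
Arguments hilbert_nontrivial {R}.

(* Unbounded operators from U to V are represented by their graphs, that is,
   by sets of pairs (x, T x) with x in the domain of T. *)
Section Graphs.
Variable (R : realType).

Definition is_subspace (V : lmodType R[i]) (S : set V) : Prop :=
  S 0 /\ forall (c : R[i]) (x y : V), S x -> S y -> S (c *: x + y).

Section TwoSpaces.
Variables (U V : normedModType R[i]).

Definition is_operator (T : set (U * V)) : Prop :=
  is_subspace T /\ forall x u v, T (x, u) -> T (x, v) -> u = v.

Definition dom (T : set (U * V)) : set U := [set x | exists u, T (x, u)].

(* The value T x; it is 0 when x is outside dom T. *)
Definition app (T : set (U * V)) (x : U) : V := xget 0 [set u | T (x, u)].

Definition densely_defined (T : set (U * V)) : Prop := dense (dom T).

(* The closure of the graph is taken in the product topology of U * V. *)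
Definition closable (T : set (U * V)) : Prop := is_operator (closure T).

Definition opp_op (T : set (U * V)) : set (U * V) :=
  [set p | T (p.1, - p.2)].

Definition is_core (S : set U) (T : set (U * V)) : Prop :=
  S `<=` dom T /\ closure [set p | T p /\ S p.1] = T.

End TwoSpaces.

Definition comp_op (U V W : normedModType R[i])
    (S : set (V * W)) (T : set (U * V)) : set (U * W) :=
  [set p | exists v, T (p.1, v) /\ S (v, p.2)].

(* The spectrum depends only on the topology of V, so that it may be computed
   for any norm equivalent to a Hilbert space norm. *)
Definition resolvent_set (V : normedModType R[i]) (T : set (V * V)) :
    set R[i] :=
  [set z | (forall w, exists! x, T (x, w + z *: x)) /\
           exists c : R, forall x w, T (x, w + z *: x) ->
             `|x| <= c%:C * `|w|].

Definition spectrum (V : normedModType R[i]) (T : set (V * V)) : set R[i] :=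
  ~` resolvent_set T.

Definition is_max (S : set R) (m : R) : Prop := S m /\ ubound S m.

End Graphs.

Section HilbertOperators.
Variable (R : realType).

Definition adjoint (H K : hilbertType R) (T : set (H * K)) : set (K * H) :=
  [set p | forall x u, T (x, u) -> inner u p.1 = inner x p.2].

Section OneSpace.
Variable (H : hilbertType R).
Implicit Types (A S T : set (H * H)).

Definition self_adjoint A : Prop :=
  [/\ is_operator A, densely_defined A & adjoint A = A].

(* The order of R[i] compares numbers with equal imaginary parts, so that
   the inequality includes the reality of its right-hand side. *)
Definition lower_bound_op A (c : R) : Prop :=
  forall x u, A (x, u) -> c%:C * `|x| ^+ 2 <= inner u x.

Definition bounded_from_below A : Prop := exists c : R, lower_bound_op A c.

Definition bounded_from_above A : Prop := bounded_from_below (opp_op A).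

(* S is the nonnegative self-adjoint square root of T. *)
Definition is_sqrt_op S T : Prop :=
  [/\ self_adjoint S, lower_bound_op S 0 & comp_op S S = T].

(* S = |A|, where |A| is the square root of A^* A. *)
Definition is_abs_op S A : Prop := is_sqrt_op S (comp_op (adjoint A) A).

(* S = |A|^{1/2}. *)
Definition is_sqrt_abs_op S A : Prop :=
  exists2 P, is_abs_op P A & is_sqrt_op S P.

(* A form with domain form_dom; its values outside form_dom are irrelevant. *)
Record sesq_form := SesqForm {
  form_dom : set H;
  form_val :> H -> H -> R[i] }.

Definition opp_form (a : sesq_form) : sesq_form :=
  SesqForm (form_dom a) (fun x y => - a x y).

Definition is_symmetric_form (a : sesq_form) : Prop :=
  [/\ is_subspace (form_dom a),
      forall (c : R[i]) x y z, form_dom a x -> form_dom a y -> form_dom a z ->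
        a (c *: x + y) z = c * a x z + a y z &
      forall x y, form_dom a x -> form_dom a y -> a x y = (a y x)^*].

Definition form_bounded_from_below (a : sesq_form) : Prop :=
  exists c : R, forall x, form_dom a x -> c%:C * `|x| ^+ 2 <= a x x.

Definition closed_form (a : sesq_form) : Prop :=
  forall (u : nat -> H) (x : H),
    (forall n, form_dom a (u n)) ->
    u @ \oo --> x ->
    (forall e : R, 0 < e -> exists N : nat, forall n m : nat,
       (N <= n)%N -> (N <= m)%N -> `|a (u n - u m) (u n - u m)| < e%:C) ->
    form_dom a x /\
    (fun n => a (u n - x) (u n - x) : R[i]^o) @ \oo --> (0 : R[i]^o).

(* The closed form associated with a self-adjoint operator A bounded from
   below (Kato's first and second representation theorems): these conditions
   determine a uniquely on its domain. *)
Definition is_form_of (A : set (H * H)) (a : sesq_form) : Prop :=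
  [/\ is_symmetric_form a,
      form_bounded_from_below a,
      closed_form a,
      exists2 S, is_sqrt_abs_op S A & form_dom a = dom S &
      forall x u y, A (x, u) -> form_dom a y ->
        form_dom a x /\ a x y = inner u y].

(* For D bounded from above the form of D is minus the form of - D;
   note that |- D| = |D|. *)
Definition is_form_of_above (D : set (H * H)) (d : sesq_form) : Prop :=
  is_form_of (opp_op D) (opp_form d).

End OneSpace.

Section BlockOperator.
Variables (H1 H2 : hilbertType R).

(* H1 * H2 carries the max norm, which is equivalent to the norm of the
   orthogonal sum of H1 and H2: closures and spectra are the same. *)
Definition block_op (A : set (H1 * H1)) (B : set (H2 * H1))
    (C : set (H1 * H2)) (D : set (H2 * H2)) :
    set ((H1 * H2) * (H1 * H2)) :=
  [set p | [/\ (dom A `&` dom C) p.1.1, (dom B `&` dom D) p.1.2 &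
     p.2 = (app A p.1.1 + app B p.1.2, app C p.1.1 + app D p.1.2)]].

(* Bs stands for the operator B^*. *)
Definition relative_bound (a : sesq_form H1) (Bs : set (H1 * H2)) : R :=
  inf [set b : R | 0 <= b /\ exists c : R, forall x, form_dom a x ->
         `|app Bs x| ^+ 2 <= c%:C * `|x| ^+ 2 + b%:C * a x x].

Definition block_form_mx (a : sesq_form H1) (d : sesq_form H2)
    (Bs : set (H1 * H2)) (x : H1) (y : H2) : 'M[R[i]]_(1 + 1) :=
  block_mx
    (a x x / `|x| ^+ 2)%:M
    (inner y (app Bs x) / (`|x| * `|y|))%:M
    (- (inner (app Bs x) y / (`|x| * `|y|)))%:M
    (d y y / `|y| ^+ 2)%:M.

Definition quadratic_numerical_range (a : sesq_form H1) (d : sesq_form H2)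
    (Bs : set (H1 * H2)) : set R[i]^o :=
  [set z | exists x y,
     [/\ form_dom a x /\ x != 0, form_dom d y /\ y != 0 &
         eigenvalue (block_form_mx a d Bs x y) z]].

End BlockOperator.

End HilbertOperators.

(* Main.v *)
(* Write E = - D. The operator M is J N, where J = diag(1, -1) and N is the
   closure of the symmetric operator [[A, B], [B^*, E]]. By the uniform
   boundedness principle |B^* x|^2 <= C (a[x] + m |x|^2) on dom a. Hence, for mu
   very negative, B^* (A - mu)^-1 B has norm at most C, and the Schur complement
   E - mu - B^* (A - mu)^-1 B is strictly positive on a core of E; so N is
   self-adjoint and the orthogonal complement of the range of M - z is
   J ker (M - conj z).

   If z is at a positive distance from the quadratic numerical range, then so is
   conj z, and |det (M_xy - z)| dominates the norm of M_xy - z uniformly in x, y.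
   By Cramer's rule M - z and M - conj z are bounded from below, so that M - z
   is bijective with a bounded inverse. *)
Require Import Defs.
From mathcomp Require Import all_boot all_order all_algebra.
From mathcomp Require Import complex ring lra.
From mathcomp Require Import all_classical all_reals all_analysis.

Set Implicit Arguments.
Unset Strict Implicit.
Unset Printing Implicit Defensive.

Import Order.TTheory GRing.Theory Num.Theory.
Import numFieldNormedType.Exports.

Local Open Scope classical_set_scope.
Local Open Scope ring_scope.
Local Open Scope complex_scope.

(** The entries of M_xy are unbounded in x and y, so a determinant bounded away from zero does not
    by itself control the inverse of M_xy - z. Two facts repair this. The off-diagonal entry grows
    at most like the square root of the upper diagonal entry, so it cannot cancel the product of two
    large diagonal entries in the determinant. And the trace, being the sum of the eigenvalues,
    keeps the moduli of the two diagonal entries of M_xy - z within a multiple of the determinant of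
    each other.

    Self-adjointness of N enters through its symmetry and, for one real mu, the dense range of N -
    mu and the surjectivity of its closure. Every bijectivity claim comes from one criterion on
    graphs, a lower bound plus a trivial orthogonal complement of the range, where orthogonality is
    tested with real parts of inner products only. *)

(** * Real-valued norms, sequences and completeness *)

Section RealNorm.
Context {R : realType}.

(** The norm of a space over [R[i]] is a complex number; its real part lives in [R], where linear
    arithmetic applies. *)
Definition nrm {V : normedZmodType R[i]} (x : V) : R := complex.Re `|x|.

Section NormedZmod.
Context {V : normedZmodType R[i]}.
Implicit Types x y : V.

Lemma nrmE x : `|x| = (nrm x)%:C.
Proof. by rewrite /nrm RRe_real// normr_real. Qed.

Lemma nrm_ge0 x : 0 <= nrm x.
Proof. by rewrite -lecR -nrmE normr_ge0. Qed.

Lemma nrmN x : nrm (- x) = nrm x.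
Proof. by rewrite /nrm normrN. Qed.

Lemma nrmD x y : nrm (x + y) <= nrm x + nrm y.
Proof. by rewrite -lecR rmorphD /= -!nrmE ler_normD. Qed.

Lemma nrmB x y : nrm (x - y) <= nrm x + nrm y.
Proof. by rewrite -(nrmN y) nrmD. Qed.

Lemma nrmC x y : nrm (x - y) = nrm (y - x).
Proof. by rewrite -nrmN opprB. Qed.

Lemma nrm0 : nrm (0 : V) = 0.
Proof. by rewrite /nrm normr0. Qed.

Lemma nrm_eq0 x : nrm x = 0 -> x = 0.
Proof. by move=> h; apply: normr0_eq0; rewrite nrmE h. Qed.

Lemma nrm_gt0 x : x != 0 -> 0 < nrm x.
Proof. by rewrite -normr_gt0 nrmE ltcR. Qed.

Lemma nrm_le0 x : nrm x <= 0 -> x = 0.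
Proof. by move=> h; apply: nrm_eq0; apply/eqP; rewrite eq_le h nrm_ge0. Qed.

Lemma nrm_small x : (forall e : R, 0 < e -> nrm x < e) -> x = 0.
Proof.
move=> h; apply: nrm_le0; rewrite leNgt; apply/negP => x0.
by have := h _ x0; rewrite ltxx.
Qed.

End NormedZmod.

Lemma nrmM (c d : R[i]) : nrm (c * d) = nrm c * nrm d.
Proof. by apply: complexI; rewrite rmorphM /= -!nrmE normrM. Qed.

Lemma nrmV (c : R[i]) : nrm c^-1 = (nrm c)^-1.
Proof. by apply: complexI; rewrite fmorphV /= -!nrmE normfV. Qed.

Lemma nrm_real (r : R) : nrm (r%:C) = `|r|.
Proof. by apply: complexI; rewrite -nrmE normc_def /= expr0n/= addr0 sqrtr_sqr. Qed.

Lemma nrmJ (c : R[i]) : nrm (conjc c) = nrm c.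
Proof. by apply: complexI; rewrite -!nrmE !normc_def; case: c => p q /=; rewrite sqrrN. Qed.

Lemma realcJ (r : R) : conjc r%:C = r%:C.
Proof. exact: conjc_real. Qed.

Lemma Re_nrm (c : R[i]) : complex.Re c <= nrm c.
Proof.
rewrite -lecR -nrmE normc_def lecR; apply: le_trans (ler_norm _) _.
by rewrite -sqrtr_sqr ler_wsqrtr// lerDl sqr_ge0.
Qed.

Lemma sqr_nrm (c : R[i]) : c * conjc c = ((nrm c) ^+ 2)%:C.
Proof. by rewrite rmorphXn /= -nrmE sqr_normc. Qed.

Section NormedMod.
Context {V : normedModType R[i]}.
Implicit Types x y : V.

Lemma nrmZ (c : R[i]) x : nrm (c *: x) = nrm c * nrm x.
Proof. by apply: complexI; rewrite rmorphM /= -!nrmE normrZ. Qed.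

Lemma closure_nrmP (S : set V) x :
  closure S x <-> forall e : R, 0 < e -> exists y, S y /\ nrm (x - y) < e.
Proof.
split=> [h e e0|h B].
  have /h [y [Sy By]] : nbhs x (ball x e%:C).
    by apply: nbhsx_ballx; rewrite ltcR.
  exists y; split => //.
  by move: By; rewrite -ball_normE /ball_ /= nrmE ltcR.
rewrite -nbhs_ballE => -[e /= e0 eB].
have er : (complex.Re e)%:C = e by rewrite RRe_real// gtr0_real.
have re0 : 0 < complex.Re e by rewrite -ltcR er.
have [y [Sy xy]] := h _ re0.
exists y; split => //; apply: eB.
by rewrite -ball_normE /ball_ /= nrmE -er ltcR.
Qed.

Definition seq_cauchy (u : nat -> V) :=
  forall e : R, 0 < e -> exists N : nat, forall n m : nat,
    (N <= n)%N -> (N <= m)%N -> nrm (u n - u m) < e.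

Definition seq_cvg (u : nat -> V) (x : V) :=
  forall e : R, 0 < e -> exists N : nat, forall n : nat,
    (N <= n)%N -> nrm (u n - x) < e.

Lemma seq_cvgP u x : u @ \oo --> x <-> seq_cvg u x.
Proof.
split=> [/cvgrPdist_lt h e e0|h].
  have [N _ hN] := h e%:C ltac:(by rewrite ltcR).
  by exists N => n /hN; rewrite /= nrmE ltcR nrmC.
apply/cvgrPdist_lt => e e0.
have er : (complex.Re e)%:C = e by rewrite RRe_real// gtr0_real.
have [N hN] := h (complex.Re e) ltac:(by rewrite -ltcR er).
by exists N => // n /= /hN; rewrite nrmE -er ltcR nrmC.
Qed.

(** A property rather than a structure, so that [H1 * H2] with the max norm qualifies as well. *)
Definition seq_complete := forall u, seq_cauchy u -> exists x, seq_cvg u x.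

End NormedMod.

Lemma banach_complete (V : completeNormedModType R[i]) : @seq_complete V.
Proof.
move=> u cu; suff : cvg (u @ \oo).
  by move=> /cvg_ex[x /seq_cvgP hx]; exists x.
apply: cauchy_cvg; apply: cauchy_exP => e e0.
have er : (complex.Re e)%:C = e by rewrite RRe_real// gtr0_real.
have [N hN] := cu (complex.Re e) ltac:(by rewrite -ltcR er).
exists (u N), N => // n /= Nn.
by rewrite -ball_normE /ball_ /= nrmE -er ltcR hN.
Qed.

Lemma nrm_pair (U V : normedModType R[i]) (p : U * V) :
  nrm p = Num.max (nrm p.1) (nrm p.2).
Proof.
apply: complexI; rewrite -nrmE prod_normE !nrmE /Order.max ltcR.
by case: ifP.
Qed.

Lemma nrm_pair_lt (U V : normedModType R[i]) (p : U * V) e :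
  (nrm p < e) = (nrm p.1 < e) && (nrm p.2 < e).
Proof. by rewrite nrm_pair gt_max. Qed.

Lemma prod_complete (U V : normedModType R[i]) :
  @seq_complete U -> @seq_complete V -> @seq_complete (U * V)%type.
Proof.
move=> cU cV u cu.
have [x hx] : exists x, seq_cvg (fun n => (u n).1) x.
  apply: cU => e /cu[N hN]; exists N => n m Nn Nm.
  by have := hN _ _ Nn Nm; rewrite nrm_pair_lt => /andP[].
have [y hy] : exists x, seq_cvg (fun n => (u n).2) x.
  apply: cV => e /cu[N hN]; exists N => n m Nn Nm.
  by have := hN _ _ Nn Nm; rewrite nrm_pair_lt => /andP[].
exists (x, y) => e e0; have [N hN] := hx _ e0; have [M hM] := hy _ e0.
exists (maxn N M) => n; rewrite geq_max => /andP[Nn Mn].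
by rewrite nrm_pair_lt /= hN// hM.
Qed.

End RealNorm.

(** * Real inner products, orthogonal projection and a resolvent criterion *)

Section RealInner.
Context {R : realType}.

Definition invS (n : nat) : R := n.+1%:R^-1.

Lemma invS_small (e : R) : 0 < e ->
  exists N : nat, forall n, (N <= n)%N -> invS n < e.
Proof.
move=> e0; rewrite /invS; have h : 0 <= e^-1 by rewrite invr_ge0 ltW.
exists (Num.bound e^-1) => n hn.
rewrite -(invrK e) ltf_pV2 ?posrE ?ltr0n ?invr_gt0//.
by apply: lt_le_trans (archi_boundP h) _; rewrite ler_nat leqW.
Qed.

Lemma invSn_gt0 (n : nat) : 0 < invS n.
Proof. by rewrite /invS invr_gt0 ltr0n. Qed.

(** Passes inequalities to the limit: approximation within e produces an error [c * e]. *)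
Lemma le_small (a b c : R) : (forall e, 0 < e -> a <= b + c * e) -> a <= b.
Proof.
move=> h; rewrite leNgt; apply/negP => ba.
have c1 : 0 < `|c| + 1 by rewrite ltr_wpDl.
have e0 : 0 < (a - b) / (2 * (`|c| + 1)) by rewrite divr_gt0 ?subr_gt0// mulr_gt0.
have := h _ e0; set e := _ / _ in e0 *.
have ee : 2 * ((`|c| + 1) * e) = a - b by rewrite /e; field; rewrite gt_eqF.
have ce : c * e <= (`|c| + 1) * e.
  by rewrite ler_pM2r// (le_trans (ler_norm c))// lerDl.
by move=> ?; lra.
Qed.

Lemma discriminant_le (p b c : R) : 0 <= c ->
  (forall t : R, 0 <= p + 2 * b * t + c * t ^+ 2) -> b ^+ 2 <= p * c.
Proof.
rewrite le_eqVlt => /orP[/eqP<- h|c0 h].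
  have [->|b0] := eqVneq b 0; first by rewrite expr0n mulr0.
  (* For [c = 0] and [b != 0] the quadratic takes the value -1 here. *)
  have := h (- (p + 1) / (2 * b)).
  have -> : 2 * b * (- (p + 1) / (2 * b)) = - (p + 1) by field.
  by move=> ?; lra.
have := h (- b / c).
have -> : p + 2 * b * (- b / c) + c * (- b / c) ^+ 2 = (p * c - b ^+ 2) / c.
  by field; rewrite gt_eqF.
by rewrite pmulr_lge0 ?invr_gt0// subr_ge0.
Qed.

Lemma norm_le_sqr (t s : R) : 0 <= s -> t ^+ 2 <= s ^+ 2 -> `|t| <= s.
Proof.
move=> s0 h; rewrite -(@ler_pXn2r _ 2) ?nnegrE ?normr_ge0//.
by rewrite real_normK ?num_real.
Qed.

Lemma sqr_le_sqr (t s : R) : 0 <= t -> t <= s -> t ^+ 2 <= s ^+ 2.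
Proof. by move=> t0 ts; rewrite ler_pXn2r ?nnegrE// (le_trans t0). Qed.

Section Spaces.
Context {V : normedModType R[i]}.

(** Covers both the real part of a Hilbert space inner product and the sum of two such forms on
    [H1 * H2]. The factor 2 in [rip_le] is the price of the max norm there. *)
Record real_inner (ip : V -> V -> R) : Prop := RealInner {
  ripC : forall x y, ip x y = ip y x;
  ripDl : forall x y w, ip (x + y) w = ip x w + ip y w;
  ripZl : forall (r : R) x y, ip (r%:C *: x) y = r * ip x y;
  rip_ge : forall x, nrm x ^+ 2 <= ip x x;
  rip_le : forall x, ip x x <= 2 * nrm x ^+ 2 }.

Section Projection.
Context {ip : V -> V -> R} (hip : real_inner ip).

Lemma ripNl x y : ip (- x) y = - ip x y.
Proof. by rewrite -scaleN1r (_ : -1 = (-1 : R)%:C) ?ripZl// ?mulN1r// rmorphN1. Qed.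

Lemma ripBl x y w : ip (x - y) w = ip x w - ip y w.
Proof. by rewrite (ripDl hip) ripNl. Qed.

Lemma ripDr x y w : ip w (x + y) = ip w x + ip w y.
Proof. by rewrite !(ripC hip w) (ripDl hip). Qed.

Lemma ripNr x y : ip y (- x) = - ip y x.
Proof. by rewrite !(ripC hip y) ripNl. Qed.

Lemma ripBr x y w : ip w (x - y) = ip w x - ip w y.
Proof. by rewrite ripDr ripNr. Qed.

Lemma ripZr (r : R) x y : ip x (r%:C *: y) = r * ip x y.
Proof. by rewrite !(ripC hip x) (ripZl hip). Qed.

Lemma rip_ge0 x : 0 <= ip x x.
Proof. by apply: le_trans (rip_ge hip x); rewrite sqr_ge0. Qed.

Lemma rip_cauchy_schwarz x y : ip x y ^+ 2 <= ip x x * ip y y.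
Proof.
apply: discriminant_le; first exact: rip_ge0.
move=> t; have := rip_ge0 (x + t%:C *: y).
rewrite !(ripDl hip, ripDr, ripZl hip, ripZr) (ripC hip y x).
by congr (_ <= _); ring.
Qed.

(** Projection theorem for a subspace that need not be closed: a minimizing sequence for the
    distance from x converges to some l in the closure of L with x - l orthogonal to L, hence x =
    l. *)
Lemma dense_of_trivial_orthogonal (L : set V) : @seq_complete R V ->
  is_subspace L ->
  (forall w, (forall v, L v -> ip v w = 0) -> w = 0) ->
  forall x e, 0 < e -> exists v, L v /\ nrm (x - v) < e.
Proof.
move=> cV [L0 hL] horth x e0 e0_gt0.
have LD u v : L u -> L v -> L (u + v).
  by move=> Lu Lv; rewrite -(scale1r u); apply: hL.
have LZ c v : L v -> L (c *: v).
  by move=> Lv; rewrite -(addr0 (c *: v)); apply: hL.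
pose q v := ip v v.
pose E : set R := [set q (x - v) | v in L].
have infE : has_inf E.
  split; first by exists (q (x - 0)), 0.
  by exists 0 => _ [v _ <-]; exact: rip_ge0.
have infP v : L v -> inf E <= q (x - v).
  by move=> Lv; apply: ge_inf; [exact: infE.2|exists v].
have /choice[v hv] : forall n : nat, exists y,
    L y /\ q (x - y) < inf E + invS n.
  move=> n.
  have [_ [y Ly <-] hy] := inf_adherent (invSn_gt0 n) infE.
  by exists y.
have [l hl] : exists l, seq_cvg v l.
  apply: cV => e e_gt0.
  have [N hN] := invS_small (e := e ^+ 2 / 4) ltac:(by rewrite divr_gt0// exprn_gt0).
  exists N => n m Nn Nm.
  have [Ln qn] := hv n; have [Lm qm] := hv m.
  have hm : L ((2^-1 : R)%:C *: (v n + v m)) by apply: LZ; apply: LD.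
  (* Parallelogram law. The midpoint lies in L, so its [q]-distance is at least the infimum, and the
     excesses e^2 / 4 add up to e^2. *)
  have par : q (v n - v m) = 2 * q (x - v n) + 2 * q (x - v m)
      - 4 * q (x - (2^-1 : R)%:C *: (v n + v m)).
    rewrite /q !(ripDl hip, ripDr, ripNl, ripNr, ripZl hip, ripZr).
    rewrite (ripC hip (v m) x) (ripC hip (v n) x) (ripC hip (v m) (v n)).
    by field.
  have := infP _ hm; have := hN _ Nn; have := hN _ Nm; have := rip_ge hip (v n - v m).
  rewrite -/(q (v n - v m)) par => h1 h2 h3 h4.
  have : nrm (v n - v m) ^+ 2 < e ^+ 2 by lra.
  by rewrite ltr_pXn2r// nnegrE ?nrm_ge0// ltW.
have w0 : x - l = 0.
  apply: horth => u Lu; apply/eqP; rewrite -sqrf_eq0 eq_le sqr_ge0 andbT.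
  (* 6 = 2 + 4: splitting x - l at v n doubles both squares, and [rip_le] doubles the second once
     more. *)
  apply: (@le_small _ _ (q u * 6)) => e e_gt0.
  have [N1 h1] := invS_small e_gt0.
  have se : 0 < Num.min e 1 by rewrite lt_min e_gt0 ltr01.
  have [N2 h2] := hl _ se.
  pose n := maxn N1 N2.
  have {}h1 := h1 n (leq_maxl _ _); have {}h2 := h2 n (leq_maxr _ _).
  have {}h2 : nrm (v n - l) ^+ 2 <= e.
    move: h2; rewrite lt_min => /andP[h2 h3]; have := nrm_ge0 (v n - l).
    by move=> ?; nra.
  have [Ln qn] := hv n.
  (* Near-minimality of v n in the direction u makes a quadratic in t with constant term [invS n]
     nonnegative. *)
  have b1 : ip u (x - v n) ^+ 2 <= invS n * q u.
    apply: discriminant_le; first exact: rip_ge0.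
    move=> t; have := infP _ (LD _ _ Ln (LZ (- t%:C) _ Lu)).
    rewrite scaleNr opprD opprK addrA {1}/q !(ripDl hip (x - v n), ripDr (x - v n)).
    rewrite ripZr (ripZl hip) ripZr (ripZl hip t u) -/(q _) -/(q _) (ripC hip (x - v n) u).
    by move=> ?; lra.
  have b2 := rip_cauchy_schwarz u (v n - l).
  have b3 := rip_le hip (v n - l).
  have qu : 0 <= q u by exact: rip_ge0.
  have -> : x - l = (x - v n) + (v n - l) by rewrite addrA subrK.
  rewrite ripDr; set A := ip u _ in b1 *; set B := ip u _ in b2 *.
  have : (A + B) ^+ 2 <= 2 * (A ^+ 2 + B ^+ 2) by have := sqr_ge0 (A - B); rewrite !expr2 => ?; lra.
  have : invS n * q u <= e * q u by rewrite ler_wpM2r// ltW.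
  have : q u * ip (v n - l) (v n - l) <= q u * (2 * e) by rewrite ler_wpM2l//; lra.
  by rewrite -/(q u) in b2; move=> *; lra.
have [N hN] := hl _ e0_gt0.
exists (v N); split; first by have [] := hv N.
by rewrite (subr0_eq w0) nrmC; exact: hN.
Qed.

End Projection.

Section Criterion.
Context {ip : V -> V -> R} (hip : real_inner ip).

Lemma closure_subspace (W : normedModType R[i]) (S : set W) :
  is_subspace S -> is_subspace (closure S).
Proof.
move=> [S0 SP]; split; first exact: subset_closure.
move=> c x y /closure_nrmP hx /closure_nrmP hy; apply/closure_nrmP => e e0.
have c1 : 0 < nrm c + 1 by rewrite ltr_wpDl// nrm_ge0.
have [x' [Sx xx]] := hx (e / (2 * (nrm c + 1))) ltac:(by rewrite divr_gt0// mulr_gt0).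
have [y' [Sy yy]] := hy (e / 2) ltac:(by rewrite divr_gt0).
exists (c *: x' + y'); split; first exact: SP.
have -> : c *: x + y - (c *: x' + y') = c *: (x - x') + (y - y').
  by rewrite opprD addrACA scalerBr.
apply: le_lt_trans (nrmD _ _) _; rewrite nrmZ.
have : (nrm c + 1) * nrm (x - x') <= (nrm c + 1) * (e / (2 * (nrm c + 1))).
  by rewrite ler_pM2l// ltW.
have -> : (nrm c + 1) * (e / (2 * (nrm c + 1))) = e / 2 by field; rewrite gt_eqF.
have := nrm_ge0 (x - x'); have := nrm_ge0 c => ? ? ?; lra.
Qed.

Lemma graph_sub (z : R[i]) (x y u v : V) :
  u - v - z *: (x - y) = (u - z *: x) - (v - z *: y).
Proof. by rewrite scalerBr !opprB addrACA [RHS]addrACA [- v + _]addrC. Qed.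

Lemma subrBB (x y w : V) : x - y = (w - y) - (w - x).
Proof. by rewrite opprB [RHS]addrC addrA subrK. Qed.

Lemma closure_lower_bound (T : set (V * V)) (z : R[i]) (K : R) : 0 <= K ->
  (forall x u, T (x, u) -> nrm x <= K * nrm (u - z *: x)) ->
  forall x u, closure T (x, u) -> nrm x <= K * nrm (u - z *: x).
Proof.
move=> K0 hT x u /closure_nrmP h.
apply: (@le_small _ _ (K * (1 + nrm z) + 1)) => e /h[[x' u'] [Tx]].
rewrite nrm_pair_lt /= => /andP[hx hu].
have h1 : nrm x <= nrm x' + nrm (x - x') by rewrite -{1}(subrKC x' x) nrmD.
have h2 : nrm (u' - z *: x') <= nrm (u - z *: x) + (nrm (u - u') + nrm z * nrm (x - x')).
  have -> : u' - z *: x' = (u - z *: x) - ((u - u') - z *: (x - x')).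
    by rewrite graph_sub subKr.
  apply: le_trans (nrmB _ _) _; rewrite lerD2l.
  by apply: le_trans (nrmB _ _) _; rewrite nrmZ.
have h3 := hT _ _ Tx.
have h4 : nrm (u' - z *: x') <= nrm (u - z *: x) + (1 + nrm z) * e.
  have : nrm z * nrm (x - x') <= nrm z * e by rewrite ler_wpM2l ?nrm_ge0// ltW.
  by move=> ?; lra.
have := ler_wpM2l K0 h4; lra.
Qed.

(** The lower bound gives injectivity, a bounded inverse and, by completeness, a closed range for
    the closure; the trivial orthogonal complement makes the range dense. Both are tested on T
    itself, so the domain of the closure need not be described. *)
Lemma resolvent_criterion (T : set (V * V)) (z : R[i]) (K : R) :
  @seq_complete R V -> is_subspace T -> 0 <= K ->
  (forall x u, T (x, u) -> nrm x <= K * nrm (u - z *: x)) ->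
  (forall w, (forall x u, T (x, u) -> ip (u - z *: x) w = 0) -> w = 0) ->
  resolvent_set (closure T) z.
Proof.
move=> cV sT K0 lT oT.
have [cT0 cTP] := closure_subspace sT.
have lcT := closure_lower_bound K0 lT.
split; last first.
  exists K => x w /lcT; rewrite addrK => h.
  by rewrite !nrmE -rmorphM /= lecR.
move=> w.
pose L : set V := [set v | exists x u, T (x, u) /\ v = u - z *: x].
have sL : is_subspace L.
  split; first by exists 0, 0; split; [exact: sT.1|rewrite scaler0 subr0].
  move=> c _ _ [x [u [Txu ->]]] [y [v [Tyv ->]]].
  exists (c *: x + y), (c *: u + v); split.
    exact: (sT.2 c _ _ Txu Tyv).
  by rewrite !scalerDr scalerN opprD addrACA !scalerA mulrC.
have dL := dense_of_trivial_orthogonal hip cV sL.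
have {}dL : forall e, 0 < e -> exists v, L v /\ nrm (w - v) < e.
  apply: dL => v hv; apply: oT => x u Txu; apply: hv.
  by exists x, u.
have /choice[p hp] : forall n : nat, exists p : V * V,
    T p /\ nrm (w - (p.2 - z *: p.1)) < invS n.
  move=> n.
  have [_ [[x [u [Txu ->]]] hx]] := dL _ (invSn_gt0 n).
  by exists (x, u).
have [x hx] : exists x, seq_cvg (fun n => (p n).1) x.
  apply: cV => e e0.
  (* K may be 0, hence K + 1. *)
  have K1 : 0 < 2 * (K + 1) by lra.
  have [N hN] := invS_small (e := e / (2 * (K + 1))) ltac:(by rewrite divr_gt0).
  exists N => n m Nn Nm; have [Tn pn] := hp n; have [Tm pm] := hp m.
  have Tnm : T ((p n).1 - (p m).1, (p n).2 - (p m).2).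
    have := sT.2 (-1) _ _ Tm Tn.
    by rewrite (surjective_pairing (p n)) (surjective_pairing (p m)) scaleN1r addrC.
  apply: le_lt_trans (lT _ _ Tnm) _.
  have -> : (p n).2 - (p m).2 - z *: ((p n).1 - (p m).1) =
      (w - ((p m).2 - z *: (p m).1)) - (w - ((p n).2 - z *: (p n).1)).
    by rewrite graph_sub; exact: subrBB.
  have := nrmB (w - ((p m).2 - z *: (p m).1)) (w - ((p n).2 - z *: (p n).1)).
  set X := nrm (_ - _) => hX.
  have X0 : 0 <= X by exact: nrm_ge0.
  have hX2 : (K + 1) * X < (K + 1) * (2 * (e / (2 * (K + 1)))).
    rewrite ltr_pM2l; last lra.
    by have := hN _ Nn; have := hN _ Nm; lra.
  have E : (K + 1) * (2 * (e / (2 * (K + 1)))) = e.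
    by field; rewrite gt_eqF//; lra.
  by rewrite E in hX2; lra.
have Tx : closure T (x, w + z *: x).
  apply/closure_nrmP => e e0.
  have z1 : 0 < 2 * (nrm z + 1) by have := nrm_ge0 z; lra.
  have [N hN] := hx (e / (2 * (nrm z + 1))) ltac:(by rewrite divr_gt0).
  have [M hM] := invS_small (e := e / 2) ltac:(by rewrite divr_gt0).
  pose n := maxn N M; exists (p n); split; first by have [] := hp n.
  have {}hN := hN n (leq_maxl _ _).
  have {}hM := hM n (leq_maxr _ _).
  have hz : (nrm z + 1) * nrm ((p n).1 - x) < e / 2.
    have -> : e / 2 = (nrm z + 1) * (e / (2 * (nrm z + 1))).
      by field; rewrite gt_eqF//; have := nrm_ge0 z; lra.
    by rewrite ltr_pM2l//; have := nrm_ge0 z; lra.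
  have nz := nrm_ge0 z; have nx := nrm_ge0 ((p n).1 - x).
  rewrite nrm_pair_lt /= nrmC; apply/andP; split; first by nra.
  have -> : w + z *: x - (p n).2 =
     w - ((p n).2 - z *: (p n).1) - z *: ((p n).1 - x).
    rewrite scalerBr !opprB -!addrA; congr (_ + _).
    by rewrite [RHS]addrC -addrA subrK addrC.
  apply: le_lt_trans (nrmB _ _) _; rewrite nrmZ.
  by have [_ pn] := hp n; lra.
exists x; split=> // y Ty; apply/eqP; rewrite -subr_eq0; apply/eqP/nrm_le0.
have := cTP (-1) _ _ Ty Tx; rewrite scaleN1r addrC => /lcT /=.
by rewrite graph_sub !addrK subrr nrm0 mulr0.
Qed.

End Criterion.
End Spaces.
End RealInner.

(** * Uniform boundedness of seminorms on a complete form domain *)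

Section UniformBoundedness.
Context {R : realType} {V : lmodType R[i]} {I : Type}.
(** P and Q stand for a form domain and the square of its form norm; the triangle inequality then
    takes the shape [QD]. *)
Context (P : set V) (Q : V -> R) (phi : I -> V -> R).
Context (P0 : P 0).
Context (PD : forall x y, P x -> P y -> P (x + y)).
Context (PZ : forall (r : R) x, P x -> P (r%:C *: x)).
Context (Q_ge0 : forall x, P x -> 0 <= Q x).
Context (QD : forall x y, P x -> P y -> Q (x + y) <= 2 * Q x + 2 * Q y).
Context (QZ : forall (r : R) x, P x -> Q (r%:C *: x) = r ^+ 2 * Q x).
Context (Q_complete : forall u : nat -> V, (forall n, P (u n)) ->
  (forall e : R, 0 < e -> exists N : nat, forall n m : nat,
     (N <= n)%N -> (N <= m)%N -> Q (u n - u m) < e) ->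
  exists x, P x /\ forall e : R, 0 < e -> exists N : nat, forall n : nat,
     (N <= n)%N -> Q (u n - x) < e).
Context (phi_ge0 : forall i x, P x -> 0 <= phi i x).
Context (phiB : forall i x y, P x -> P y -> phi i (x - y) <= phi i x + phi i y).
Context (phiZ : forall i (r : R) x, P x -> phi i (r%:C *: x) = `|r| * phi i x).
Context (phi_bounded : forall i, exists k : R,
  forall x, P x -> phi i x ^+ 2 <= k * Q x).
Context (phi_pointwise : forall x, P x -> exists F : R, forall i, phi i x <= F).

Let PN x : P x -> P (- x).
Proof. by move=> /(PZ (-1)); rewrite rmorphN1 scaleN1r. Qed.

Let QN x : P x -> Q (- x) = Q x.
Proof. by move=> /(QZ (-1)); rewrite rmorphN1 scaleN1r sqrrN expr1n mul1r. Qed.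

(** The last component is taken to be the least c with phi^2 <= c Q, a squared operator norm.
    Unboundedness of the family pushes it above C, and a vector normalized by Q attains at least
    half of it. *)
Let phi_norming C : 1 <= C ->
  (forall K : R, exists i x, P x /\ K * Q x < phi i x ^+ 2) ->
  exists p : I * V * R, [/\ P p.1.2, Q p.1.2 = 1, C <= p.2,
    p.2 / 2 <= phi p.1.1 p.1.2 ^+ 2 &
    forall y, P y -> phi p.1.1 y ^+ 2 <= p.2 * Q y].
Proof.
move=> C1 /(_ C)[i [x0 [Px0 hx0]]].
pose E : set R := [set c | forall x, P x -> phi i x ^+ 2 <= c * Q x].
have Qx0 : 0 < Q x0.
  rewrite lt_def Q_ge0// andbT; apply/eqP => Q0; have [k hk] := phi_bounded i.
  by have := hk _ Px0; move: hx0; rewrite Q0 !mulr0 => h1 h2; lra.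
have EC c : E c -> C <= c.
  move=> Ec; have := Ec _ Px0 => h; rewrite leNgt; apply/negP => cC.
  have : c * Q x0 < C * Q x0 by rewrite ltr_pM2r.
  by move=> ?; lra.
have infE : has_inf E.
  by split; [exact: phi_bounded|exists C => c /EC].
pose s := inf E.
have sC : C <= s by apply: lb_le_inf; [exact: infE.1|exact: EC].
have Es : E s.
  move=> y Py; apply: (@le_small _ _ _ (Q y)) => e e0.
  have [c Ec cs] := inf_adherent e0 infE.
  apply: le_trans (Ec _ Py) _; rewrite (mulrC (Q y)) -mulrDl ler_wpM2r// ?Q_ge0//.
  exact: ltW.
have [x [Px hx]] : exists x, P x /\ s / 2 * Q x < phi i x ^+ 2.
  apply: contrapT => h; have : E (s / 2).
    move=> x Px; rewrite leNgt; apply/negP => hx; apply: h; by exists x.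
  by move=> /(ge_inf infE.2); rewrite -/s; lra.
have Qx : 0 < Q x.
  rewrite lt_def Q_ge0// andbT; apply/eqP => Q0.
  by have := Es _ Px; move: hx; rewrite Q0 !mulr0 => h1 h2; lra.
pose r := (Num.sqrt (Q x))^-1.
have r2 : r ^+ 2 * Q x = 1.
  by rewrite exprVn sqr_sqrtr ?ltW// mulVf// gt_eqF.
exists (i, r%:C *: x, s); split => //=.
- exact: PZ.
- by rewrite QZ.
rewrite phiZ// exprMn real_normK ?num_real//.
have r0 : 0 < r ^+ 2 by rewrite exprn_gt0// invr_gt0 sqrtr_gt0.
have : r ^+ 2 * (s / 2 * Q x) <= r ^+ 2 * phi i x ^+ 2 by rewrite ler_pM2l// ltW.
by rewrite mulrCA r2 mulr1.
Qed.

(* Sokal's gliding hump: the n-th step has size 8^(-n-1) and its sign is chosen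
   so that it does not decrease the n-th seminorm. *)
Lemma uniform_boundedness :
  exists K : R, forall i x, P x -> phi i x ^+ 2 <= K * Q x.
Proof.
apply: contrapT => hK.
have {}hK K : exists i x, P x /\ K * Q x < phi i x ^+ 2.
  apply: contrapT => h; apply: hK; exists K => i x Px.
  by rewrite leNgt; apply/negP => ?; apply: h; exists i, x.
(* The factor 64^(n+1) offsets the squared step size 8^(-2(n+1)); the n + 1 that survives
   diverges. *)
have /choice[p hp] : forall n : nat, exists p : I * V * R,
    [/\ P p.1.2, Q p.1.2 = 1, n.+1%:R * 64 ^+ n.+1 <= p.2,
    p.2 / 2 <= phi p.1.1 p.1.2 ^+ 2 &
    forall y, P y -> phi p.1.1 y ^+ 2 <= p.2 * Q y].
  move=> n; apply: phi_norming => //.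
  by rewrite -[leLHS]mulr1 ler_pM// ?ler1n// exprn_ege1// ler1n.
pose i n := (p n).1.1; pose s n := (p n).2; pose w n := (8^-1 ^+ n.+1 : R).
pose v n := (w n)%:C *: (p n).1.2.
(* [pw n.+1] is the squared size of the n-th step; it is kept abstract so that the estimates below
   are linear in it. *)
have [pw [pw0 pwS pwE]] : exists pw : nat -> R,
    [/\ forall n, 0 < pw n, forall n, pw n.+1 = pw n / 64 &
        forall n, pw n = (64 ^+ n)^-1].
  have h n : 0 < (64 ^+ n)^-1 :> R by rewrite invr_gt0 exprn_gt0.
  exists (fun n => (64 ^+ n)^-1); split=> // n.
  by rewrite exprS invfM mulrC.
have w2 n : w n ^+ 2 = pw n.+1.
  by rewrite pwE /w -exprM mulnC exprM exprVn expr2 -natrM exprVn.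
have Pv n : P (v n) by apply: PZ; have [] := hp n.
have Qv n : Q (v n) = pw n.+1.
  by have [Pn Qn _ _ _] := hp n; rewrite /v QZ// Qn mulr1 w2.
have phiv n : pw n.+1 * (s n / 2) <= phi (i n) (v n) ^+ 2.
  have [Px _ _ h _] := hp n; rewrite phiZ// exprMn real_normK ?num_real// w2.
  by rewrite ler_pM2l.
have /choice[f hf] : forall nx : nat * V, exists y, P nx.2 ->
    [/\ P y, Q (y - nx.2) = pw nx.1.+1 & phi (i nx.1) (v nx.1) <= phi (i nx.1) y].
  move=> [n x] /=; have [Px|nPx] := pselect (P x); last by exists 0.
  have Pp : P (x + v n) by apply: PD.
  have Pm : P (x - v n) by apply: PD => //; apply: PN.
  (* Twice v n is the difference of the two candidates, so one of them has at least the seminorm of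
     v n. *)
  have h : 2 * phi (i n) (v n) <= phi (i n) (x + v n) + phi (i n) (x - v n).
    apply: le_trans (phiB _ Pp Pm).
    rewrite opprB addrC addrA subrK -mulr2n.
    have -> : v n *+ 2 = (2 : R)%:C *: v n by rewrite rmorph_nat scaler_nat.
    by rewrite phiZ// ger0_norm.
  have [hp1|hp1] := leP (phi (i n) (v n)) (phi (i n) (x + v n)).
    by exists (x + v n) => _; split => //; rewrite addrAC subrr add0r Qv.
  exists (x - v n) => _; split => //; last lra.
  by rewrite addrAC subrr add0r QN// Qv.
pose u := fix u n := if n is m.+1 then f (m, u m) else 0.
have Pu n : P (u n).
  by elim: n => // n Pun; have [] := hf (n, u n) Pun.
have uS n : Q (u n.+1 - u n) = pw n.+1 by have [] := hf (n, u n) (Pu n).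
have uphi n : phi (i n) (v n) <= phi (i n) (u n.+1).
  by have [] := hf (n, u n) (Pu n).
have PB x y : P x -> P y -> P (x - y) by move=> Px Py; apply: PD => //; apply: PN.
(* The induction closes because 2 (1/16) / 64 + 2 / 64 <= 1/16. *)
have tail k n : Q (u (n + k)%N - u n) <= pw n / 16.
  elim: k n => [|k IH] n.
    rewrite addn0 subrr -(scale0r 0) (QZ 0)// expr0n mul0r divr_ge0//.
    exact: ltW.
  have := IH n.+1; rewrite addSnnS => h.
  have := QD (PB _ _ (Pu (n + k.+1)%N) (Pu n.+1)) (PB _ _ (Pu n.+1) (Pu n)).
  rewrite addrA subrK uS => h2; rewrite pwS in h h2.
  by have := pw0 n; lra.
have pw_small e : 0 < e -> exists N : nat, forall n, (N <= n)%N -> pw n < e.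
  move=> /invS_small[N hN]; exists N => n Nn.
  apply: le_lt_trans (hN _ Nn); rewrite pwE /invS lef_pV2 ?posrE ?exprn_gt0//.
  by rewrite -natrX ler_nat ltn_expl.
have [x [Px hx]] : exists x, P x /\ forall e : R, 0 < e ->
    exists N : nat, forall n : nat, (N <= n)%N -> Q (u n - x) < e.
  apply: Q_complete => // e /pw_small[N hN]; exists N => n m Nn Nm.
  have h1 := tail (n - N)%N N; have h2 := tail (m - N)%N N.
  rewrite !subnKC// in h1 h2; have := hN _ (leqnn N).
  have := QD (PB _ _ (Pu n) (Pu N)) (PB _ _ (Pu N) (Pu m)).
  rewrite addrA subrK -(QN (PB _ _ (Pu N) (Pu m))) opprB => h3 h4.
  by have := pw0 N; lra.
have Qx n : Q (u n - x) <= pw n / 8.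
  apply: (@le_small _ _ _ 2) => e /hx[N hN].
  have h1 := tail N n; have h2 := hN (n + N)%N (leq_addl _ _).
  have := QD (PB _ _ (Pu n) (Pu (n + N)%N)) (PB _ _ (Pu (n + N)%N) Px).
  by rewrite addrA subrK -(QN (PB _ _ (Pu n) (Pu (n + N)%N))) opprB => h3; lra.
have [F hF] := phi_pointwise Px.
(* With T = [pw n.+1 * s n], the estimates below give T / 2 <= T / 4 + 2 F^2, that is T <= 8 F^2,
   whereas T >= n + 1. *)
pose n := Num.bound (8 * F ^+ 2).
have hn : 8 * F ^+ 2 < n%:R by apply: archi_boundP; rewrite mulr_ge0// sqr_ge0.
have [_ _ hs _ hphi] := hp n; rewrite -/(s n) -/(i n) in hs hphi.
have a1 := phiv n; have a2 := uphi n; have a3 := hphi _ (PB _ _ (Pu n.+1) Px).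
have a4 : s n * Q (u n.+1 - x) <= s n * (pw n.+1 / 8).
  rewrite ler_wpM2l//; apply: le_trans hs; rewrite mulr_ge0//.
have a5 := hF (i n); have a6 := phi_ge0 (i n) Px.
have a7 : phi (i n) (u n.+1) <= phi (i n) (u n.+1 - x) + phi (i n) x.
  have := phiB (i n) (PB _ _ (Pu n.+1) Px) (PN Px).
  rewrite opprK subrK => h; apply: le_trans h _; rewrite lerD2l.
  by have := phiZ (i n) (-1) Px; rewrite rmorphN1 scaleN1r normrN1 mul1r => ->.
have a8 : n.+1%:R <= pw n.+1 * s n.
  by rewrite pwE mulrC ler_pdivlMr ?exprn_gt0.
have a9 := phi_ge0 (i n) (Pv n); have a10 := phi_ge0 (i n) (PB _ _ (Pu n.+1) Px).
rewrite -natr1 in a8.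
set X := phi _ (v n) in a1 a2 a9; set Y := phi _ (u n.+1) in a2 a7.
set Z := phi _ (_ - x) in a3 a7 a10; set W := phi _ x in a5 a6 a7.
have b1 : W ^+ 2 <= F ^+ 2 by rewrite ler_pXn2r// nnegrE// (le_trans a6).
have b2 : X ^+ 2 <= (Z + W) ^+ 2.
  by rewrite ler_pXn2r// ?nnegrE ?addr_ge0// (le_trans a2).
have b3 : (Z + W) ^+ 2 <= 2 * Z ^+ 2 + 2 * W ^+ 2.
  by have := sqr_ge0 (Z - W); rewrite !expr2 => ?; lra.
have b4 : pw n.+1 * (s n / 2) = (pw n.+1 * s n) / 2 by rewrite mulrA.
have b5 : s n * (pw n.+1 / 8) = (pw n.+1 * s n) / 8 by rewrite mulrA (mulrC (s n)).
by rewrite b4 b5 in a1 a4; lra.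
Qed.

End UniformBoundedness.

(** * Hilbert spaces and their orthogonal sum *)

Section Hilbert.
Context {R : realType}.

Section OneHilbert.
Context {H : hilbertType R}.
Implicit Types x y w : H.

Lemma innerC x y : inner y x = conjc (inner x y).
Proof. by rewrite hermC expr0 mul1r. Qed.

Lemma innerDl x y w : inner (x + y) w = inner x w + inner y w.
Proof. exact: linearDl. Qed.

Lemma innerZl (c : R[i]) x y : inner (c *: x) y = c * inner x y.
Proof. by rewrite linearZl_LR. Qed.

Lemma innerDr x y w : inner w (x + y) = inner w x + inner w y.
Proof. exact: linearDr. Qed.

Lemma innerZr (c : R[i]) x y : inner y (c *: x) = conjc c * inner y x.
Proof. by rewrite linearZr_LR. Qed.

Lemma innerNl x y : inner (- x) y = - inner x y.
Proof. exact: linearNl. Qed.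

Lemma innerNr x y : inner y (- x) = - inner y x.
Proof. exact: linearNr. Qed.

Lemma innerBl x y w : inner (x - y) w = inner x w - inner y w.
Proof. exact: linearBl. Qed.

Lemma innerBr x y w : inner w (x - y) = inner w x - inner w y.
Proof. exact: linearBr. Qed.

Lemma inner_nrm x : inner x x = (nrm x ^+ 2)%:C.
Proof. by rewrite inner_norm nrmE rmorphXn. Qed.

Definition rip x y : R := complex.Re (inner x y).

Lemma ReJ (c : R[i]) : complex.Re (conjc c) = complex.Re c.
Proof. by case: c. Qed.

Lemma ReD (c e : R[i]) : complex.Re (c + e) = complex.Re c + complex.Re e.
Proof. by case: c; case: e. Qed.

Lemma ReZ (r : R) (c : R[i]) : complex.Re (r%:C * c) = r * complex.Re c.
Proof. by case: c => p q /=; rewrite mul0r subr0. Qed.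

Lemma rip_nrm x : rip x x = nrm x ^+ 2.
Proof. by rewrite /rip inner_nrm. Qed.

Lemma rip_inner : real_inner rip.
Proof.
split=> [x y|x y w|r x y|x|x]; rewrite ?rip_nrm// /rip.
- by rewrite innerC ReJ.
- by rewrite innerDl ReD.
- by rewrite innerZl ReZ.
- by have := sqr_ge0 (nrm x); lra.
Qed.

(** Rotating x by a phase turns the real part of the inner product into its modulus, so the real
    inequality suffices. *)
Lemma cauchy_schwarz x y : nrm (inner x y) <= nrm x * nrm y.
Proof.
have [i0|i0] := eqVneq (nrm (inner x y)) 0.
  by rewrite i0 mulr_ge0// nrm_ge0.
pose c := (nrm (inner x y))^-1%:C * conjc (inner x y).
have hc : c * inner x y = (nrm (inner x y))%:C.
  rewrite /c -mulrA (mulrC (conjc _)) sqr_nrm -rmorphM /= expr2 mulrA mulVf//.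
  by rewrite mul1r.
have nc : nrm c = 1.
  by rewrite nrmM nrm_real nrmJ ger0_norm ?invr_ge0 ?nrm_ge0// mulVf.
have := rip_cauchy_schwarz rip_inner (c *: x) y.
rewrite {1}/rip innerZl hc !rip_nrm nrmZ nc mul1r -exprMn /=.
by rewrite ler_pXn2r// nnegrE ?mulr_ge0 ?nrm_ge0.
Qed.

Lemma rip_le_nrm x y : rip x y <= nrm x * nrm y.
Proof. exact: le_trans (Re_nrm _) (cauchy_schwarz _ _). Qed.

Lemma hilbert_complete : @seq_complete R H.
Proof. exact: banach_complete. Qed.

Lemma inner_eq (S : set H) x y : (forall u e, 0 < e -> exists v, S v /\ nrm (u - v) < e) ->
  (forall v, S v -> inner v x = inner v y) -> x = y.
Proof.
move=> dS h; apply/eqP; rewrite -subr_eq0; apply/eqP/nrm_small => e e0.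
have [v [Sv hv]] := dS (x - y) e e0.
have hx : inner v (x - y) = 0 by rewrite innerBr h// subrr.
have := cauchy_schwarz (x - y - v) (x - y).
rewrite innerBl hx subr0 inner_nrm nrm_real ger0_norm ?sqr_ge0// expr2.
have [n0|n0] := ltP 0 (nrm (x - y)).
  by rewrite ler_pM2r// => h2; apply: le_lt_trans h2 hv.
by move=> _; apply: le_lt_trans n0 e0.
Qed.

End OneHilbert.

Lemma dense_nrm {V : normedModType R[i]} (S : set V) : dense S ->
  forall u e, 0 < e -> exists v, S v /\ nrm (u - v) < e.
Proof.
move=> dS u e e0.
have : closure S u.
  move=> B; rewrite nbhsE => -[U [oU Uu] UB].
  have [v [Uv Sv]] := dS U (ex_intro _ u Uu) oU.
  by exists v; split => //; exact: UB.
by move=> /closure_nrmP; exact.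
Qed.

Section Product.
Context {H1 H2 : hilbertType R}.

(** Real part of the inner product of the orthogonal sum; [nrm] on [H1 * H2] remains the max
    norm. *)
Definition pip (p q : H1 * H2) : R := rip p.1 q.1 + rip p.2 q.2.

Lemma pip_inner : real_inner pip.
Proof.
have h1 := @rip_inner H1; have h2 := @rip_inner H2.
split=> [p q|p q w|r p q|p|p]; rewrite /pip /=.
- by rewrite (ripC h1) (ripC h2).
- by rewrite (ripDl h1) (ripDl h2) addrACA.
- by rewrite (ripZl h1) (ripZl h2) mulrDr.
- rewrite !rip_nrm nrm_pair; have := sqr_ge0 (nrm p.1); have := sqr_ge0 (nrm p.2).
  by rewrite /Order.max; case: ifP => _; lra.
- rewrite !rip_nrm nrm_pair; have := nrm_ge0 p.1; have := nrm_ge0 p.2.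
  by rewrite /Order.max; case: ltP => *; nra.
Qed.

End Product.

(** Testing also with ['i *: v] recovers the imaginary part. *)
Lemma real_orthogonal {H : hilbertType R} (S : set H) w :
  is_subspace S -> (forall v, S v -> rip v w = 0) -> forall v, S v -> inner v w = 0.
Proof.
move=> [S0 SP] h v Sv.
have h2 : rip ('i *: v) w = 0 by apply: h; rewrite -[X in S X]addr0; apply: SP.
move: (h _ Sv) h2; rewrite /rip innerZl; case: (inner v w) => p q /= -> /eqP.
by rewrite mul0r mul1r sub0r oppr_eq0 => /eqP ->.
Qed.

End Hilbert.

(** * Adjoints and semibounded self-adjoint operators *)

Section Operators.
Context {R : realType}.

Lemma adjoint_closed (H K : hilbertType R) (T : set (H * K)) (p : K * H) :
  closure (adjoint T) p -> adjoint T p.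
Proof.
move=> /closure_nrmP h x u Txu; apply/eqP; rewrite -subr_eq0; apply/eqP/nrm_le0.
apply: (@le_small _ _ _ (nrm u + nrm x)) => e /h[q [Tq]].
rewrite nrm_pair_lt /= => /andP[h1 h2]; rewrite add0r.
have -> : inner u p.1 - inner x p.2 = inner u (p.1 - q.1) - inner x (p.2 - q.2).
  by rewrite !innerBr opprB (Tq _ _ Txu) addrA subrK.
apply: le_trans (nrmB _ _) _.
have := cauchy_schwarz u (p.1 - q.1); have := cauchy_schwarz x (p.2 - q.2).
have : nrm u * nrm (p.1 - q.1) <= nrm u * e by rewrite ler_wpM2l ?nrm_ge0 ?ltW.
have : nrm x * nrm (p.2 - q.2) <= nrm x * e by rewrite ler_wpM2l ?nrm_ge0 ?ltW.
by move=> *; lra.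
Qed.

Lemma adjoint_subspace (H K : hilbertType R) (T : set (H * K)) :
  is_subspace (adjoint T).
Proof.
split=> [x u _|c p q hp hq x u Txu] /=; first by rewrite !linear0r.
by rewrite !innerDr !innerZr (hp _ _ Txu) (hq _ _ Txu).
Qed.

Lemma adjoint_operator (H K : hilbertType R) (T : set (H * K)) :
  densely_defined T -> is_operator (adjoint T).
Proof.
move=> dT; split; first exact: adjoint_subspace.
move=> x u v hu hv; apply: (inner_eq (dense_nrm dT)) => y [t Tyt].
by rewrite -(hu _ _ Tyt) -(hv _ _ Tyt).
Qed.

Section OneSpace.
Context {H : hilbertType R}.
Implicit Types A T : set (H * H).

Lemma lower_bound_rip T (c : R) x u :
  lower_bound_op T c -> T (x, u) -> c * nrm x ^+ 2 <= rip u x.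
Proof.
move=> h /h; rewrite nrmE -rmorphXn -rmorphM /= lecE => /andP[_].
by [].
Qed.

Lemma lower_bound_resolvent T (c mu : R) x u :
  lower_bound_op T c -> T (x, u) -> (c - mu) * nrm x <= nrm (u - mu%:C *: x).
Proof.
move=> lT Txu; have := lower_bound_rip lT Txu.
have := rip_le_nrm (u - mu%:C *: x) x.
rewrite (ripBl rip_inner) (ripZl rip_inner) rip_nrm.
have [x0|x0] := ltP 0 (nrm x); last first.
  have -> : nrm x = 0 by apply/eqP; rewrite eq_le x0 nrm_ge0.
  by move=> _ _; rewrite mulr0 nrm_ge0.
move=> h1 h2; rewrite -(ler_pM2r x0); apply: le_trans h1.
by rewrite mulrBl mulrBl -!mulrA -expr2; lra.
Qed.

(** By self-adjointness a vector orthogonal to the range of A - mu lies in its kernel, which is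
    trivial because mu < c; and A is closed, being an adjoint. *)
Lemma self_adjoint_resolvent A (c mu : R) :
  self_adjoint A -> lower_bound_op A c -> mu < c -> resolvent_set A mu%:C.
Proof.
move=> [[sA oA] dA adjA] lA muc.
have clA : closure A = A.
  apply/seteqP; split; last exact: subset_closure.
  by rewrite -{1}adjA -{2}adjA => p /adjoint_closed.
rewrite -clA; apply: (@resolvent_criterion _ _ _ rip_inner A mu%:C (c - mu)^-1) => //.
- exact: hilbert_complete.
- by rewrite invr_ge0 subr_ge0 ltW.
- move=> x u Axu; rewrite mulrC ler_pdivlMr ?subr_gt0// mulrC.
  exact: lower_bound_resolvent lA Axu.
move=> w hw.
have Aw : A (w, mu%:C *: w).
  rewrite -adjA => x u Axu /=.
  pose S : set H := [set v | exists x u, A (x, u) /\ v = u - mu%:C *: x].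
  have sS : is_subspace S.
    split; first by exists 0, 0; split; [exact: sA.1|rewrite scaler0 subr0].
    move=> k _ _ [x1 [u1 [h1 ->]]] [y [v [h2 ->]]].
    exists (k *: x1 + y), (k *: u1 + v); split.
      exact: (sA.2 k _ _ h1 h2).
    by rewrite !scalerDr scalerN opprD addrACA !scalerA mulrC.
  have oS : forall v, S v -> rip v w = 0.
    by move=> _ [x1 [u1 [h1 ->]]]; exact: hw.
  have : inner (u - mu%:C *: x) w = 0.
    by apply: (real_orthogonal sS oS); exists x, u.
  rewrite innerBl innerZl innerZr realcJ => /eqP.
  by rewrite subr_eq0 => /eqP.
have := lower_bound_rip lA Aw; rewrite (ripZl rip_inner) rip_nrm => h.
have : nrm w ^+ 2 <= 0.
  rewrite leNgt; apply/negP => h0.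
  have : mu * nrm w ^+ 2 < c * nrm w ^+ 2 by rewrite ltr_pM2r.
  by rewrite ltNge h.
move=> h0; apply: nrm_eq0; apply/eqP; rewrite -sqrf_eq0 eq_le h0.
exact: sqr_ge0.
Qed.

Lemma opp_self_adjoint A : self_adjoint A -> self_adjoint (opp_op A).
Proof.
move=> [[[A0 AP] oA] dA adjA]; split.
- split; last by move=> x u v h1 h2; apply: oppr_inj; apply: oA h1 h2.
  split; first by rewrite /opp_op /= oppr0.
  move=> c p q h1 h2; rewrite /opp_op /= opprD -scalerN.
  exact: (AP c _ _ h1 h2).
- rewrite /densely_defined; have -> // : dom (opp_op A) = dom A.
  apply/seteqP; split=> x [u hu]; exists (- u) => //.
  by rewrite /opp_op /= opprK.
- apply/seteqP; split=> -[x u] h.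
    rewrite /opp_op /= -adjA => y v hy /=.
    have : opp_op A (y, - v) by rewrite /opp_op /= opprK.
    by move=> /h /=; rewrite innerNl innerNr => <-; rewrite opprK.
  move=> y v hy /=; move: h; rewrite /opp_op /= -adjA => /(_ _ _ hy) /=.
  by rewrite innerNl innerNr => /oppr_inj.
Qed.

End OneSpace.

(** * Form boundedness of the adjoint of B *)

Section RelativeBound.
Context {H1 H2 : hilbertType R} (a : sesq_form H1) (B : set (H2 * H1)).
Context (sym_a : is_symmetric_form a).
Context (low_a : form_bounded_from_below a).
Context (closed_a : closed_form a).
Context (subB : is_subspace B).
Context (denseB : densely_defined B).
Context (domB : form_dom a `<=` dom (adjoint B)).

Let P := form_dom a.
Let ra x y : R := complex.Re (a x y).

Let PD x y : P x -> P y -> P (x + y).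
Proof.
by have [[_ h] _ _] := sym_a => Px Py; rewrite -(scale1r x); apply: h.
Qed.

Let PZ c x : P x -> P (c *: x).
Proof.
by have [[h0 h] _ _] := sym_a => Px; rewrite -(addr0 (c *: x)); apply: h.
Qed.

Let PB x y : P x -> P y -> P (x - y).
Proof. by move=> Px Py; rewrite -(scaleN1r y); apply: PD => //; apply: PZ. Qed.

Let raC x y : P x -> P y -> ra x y = ra y x.
Proof. by have [_ _ h] := sym_a => Px Py; rewrite /ra h// ReJ. Qed.

Let raDl x y w : P x -> P y -> P w -> ra (x + y) w = ra x w + ra y w.
Proof.
have [_ h _] := sym_a => Px Py Pw.
by rewrite /ra -[x in LHS]scale1r h// mul1r ReD.
Qed.

Let raZl (r : R) x w : P x -> P w -> ra (r%:C *: x) w = r * ra x w.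
Proof.
have [[P0 _] h _] := sym_a => Px Pw.
have a0 : a 0 w = 0.
  have := h 0 0 0 w P0 P0 Pw; rewrite scale0r addr0 mul0r add0r => /eqP.
  by have := h 1 0 0 w P0 P0 Pw; rewrite scaler0 addr0 mul1r => /eqP;
     rewrite -subr_eq0 opprD addrA subrr sub0r oppr_eq0 => /eqP.
by rewrite /ra -[_ *: x]addr0 h// a0 addr0 ReZ.
Qed.

Let aRe x : P x -> a x x = (ra x x)%:C.
Proof.
have [_ _ h] := sym_a => Px; have := h _ _ Px Px; rewrite /ra.
by case: (a x x) => p q [] /eqP; rewrite -addr_eq0 -mulr2n mulrn_eq0 => /= /eqP ->.
Qed.

(** The functionals x -> <x, B y>, with y in the unit ball of dom B, are each bounded in Q = a + m
    |x|^2 because Q dominates |x|^2, and pointwise bounded because <x, B y> = <B^* x, y>. The form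
    domain is complete for Q, and density of dom B turns the uniform bound into one on |B^* x|. *)
Lemma form_relative_bound : exists m C : R, [/\ 1 <= C,
  forall x, form_dom a x -> nrm x ^+ 2 <= complex.Re (a x x) + m * nrm x ^+ 2 &
  forall x w, form_dom a x -> adjoint B (x, w) ->
    nrm w ^+ 2 <= C * (complex.Re (a x x) + m * nrm x ^+ 2)].
Proof.
(* The summand |c| makes the shifted form nonnegative, and the extra 1 makes it dominate the squared
   norm. *)
have [c hc] := low_a; pose m := `|c| + 1.
have m0 : 1 <= m by rewrite lerDr.
pose Q x : R := ra x x + m * nrm x ^+ 2.
have Qn x : P x -> nrm x ^+ 2 <= Q x.
  move=> Px; have := hc _ Px; rewrite aRe// nrmE -rmorphXn -rmorphM /= lecR => h.
  have : - `|c| * nrm x ^+ 2 <= c * nrm x ^+ 2.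
    by rewrite ler_wpM2r ?sqr_ge0// lerNl -normrN ler_norm.
  by rewrite /Q /m mulrDl mulNr; lra.
have QE x : Q x = ra x x + m * rip x x by rewrite /Q rip_nrm.
have Q0 x : P x -> 0 <= Q x.
  by move=> /Qn; apply: le_trans; rewrite sqr_ge0.
have QZ (r : R) x : P x -> Q (r%:C *: x) = r ^+ 2 * Q x.
  move=> Px; have Prx := PZ r%:C Px.
  rewrite /Q (raZl r Px Prx) (raC Px Prx) (raZl r Px Px).
  by rewrite nrmZ nrm_real exprMn real_normK ?num_real//; ring.
(* The difference of the two sides is Q (x - y). *)
have QD x y : P x -> P y -> Q (x + y) <= 2 * Q x + 2 * Q y.
  move=> Px Py; have Pxy := PB Px Py; have PDxy := PD Px Py.
  have PNy : P (- y) by rewrite -scaleN1r; exact: PZ.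
  have raN w : P w -> ra (- y) w = - ra y w.
    by move=> Pw; have := raZl (-1) Py Pw; rewrite rmorphN1 scaleN1r mulN1r.
  have := Q0 _ Pxy; rewrite !QE.
  have f1 : ra (x - y) (x - y) = ra x x - 2 * ra x y + ra y y.
    rewrite (raDl Px PNy Pxy) (raN _ Pxy) (raC Px Pxy) (raC Py Pxy).
    rewrite (raDl Px PNy Px) (raDl Px PNy Py) !raN// (raC Py Px).
    by ring.
  have f2 : ra (x + y) (x + y) = ra x x + 2 * ra x y + ra y y.
    rewrite (raDl Px Py PDxy) (raC Px PDxy) (raC Py PDxy).
    rewrite (raDl Px Py Px) (raDl Px Py Py) (raC Py Px).
    by ring.
  rewrite f1 f2.
  have hr := @rip_inner _ H1.
  rewrite !(ripDl hr, ripDr hr, ripNl hr, ripNr hr) (ripC hr y x).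
  by move=> h; lra.
pose I := {p : H2 * H1 | B p /\ nrm p.1 <= 1}.
pose phi (i : I) (x : H1) : R := nrm (inner x (sval i).2).
have [K hK] : exists K : R, forall i x, P x -> phi i x ^+ 2 <= K * Q x.
  apply: (@uniform_boundedness R H1 I P Q phi) => //.
  - by have [[? _] _ _] := sym_a.
  - by move=> r x; exact: PZ.
  - move=> u Pu hu.
    have [x hx] : exists x, seq_cvg u x.
      apply: hilbert_complete => e e0.
      have [N hN] := hu (e ^+ 2) ltac:(by rewrite exprn_gt0).
      exists N => n k Nn Nk; have := hN _ _ Nn Nk.
      have := Qn _ (PB (Pu n) (Pu k)) => h1 h2.
      have : nrm (u n - u k) ^+ 2 < e ^+ 2 by apply: le_lt_trans h2.
      by rewrite ltr_pXn2r// nnegrE ?nrm_ge0// ltW.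
    have m1 : 0 < 1 + m by lra.
    have [Px ax] : form_dom a x /\
        (fun n => a (u n - x) (u n - x) : R[i]^o) @ \oo --> (0 : R[i]^o).
      apply: closed_a => //; first exact/seq_cvgP.
      (* |a[v]| <= Q v + m |v|^2 <= (1 + m) Q v. *)
      move=> e e0; have [N hN] := hu (e / (1 + m)) ltac:(by rewrite divr_gt0).
      exists N => n k Nn Nk; have := hN _ _ Nn Nk.
      rewrite ltr_pdivlMr// => h.
      have Pnk := PB (Pu n) (Pu k).
      rewrite nrmE ltcR; apply: le_lt_trans h; rewrite aRe// nrm_real.
      have h1 := Qn _ Pnk; have h2 := Q0 _ Pnk; have h3 := sqr_ge0 (nrm (u n - u k)).
      have h4 : m * nrm (u n - u k) ^+ 2 <= m * Q (u n - u k) by rewrite ler_wpM2l//; lra.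
      have h5 : 0 <= m * nrm (u n - u k) ^+ 2 by rewrite mulr_ge0//; lra.
      have h6 : ra (u n - u k) (u n - u k) = Q (u n - u k) - m * nrm (u n - u k) ^+ 2.
        by rewrite /Q addrK.
      by rewrite h6 ler_norml; apply/andP; split; lra.
    exists x; split => // e e0.
    have [N hN] := (seq_cvgP _ _).1 ax (e / 2) ltac:(by rewrite divr_gt0).
    have em : 0 < e / (2 * m) by rewrite divr_gt0//; lra.
    have [M hM] := hx (Num.min (e / (2 * m)) 1) ltac:(by rewrite lt_min em ltr01).
    exists (maxn N M) => n; rewrite geq_max => /andP[Nn Mn].
    have := hM _ Mn; have := hN _ Nn.
    rewrite subr0 aRe; last exact: PB.
    rewrite nrm_real lt_min => h1 /andP[h2 h3].
    have h4 := ler_norm (ra (u n - x) (u n - x)).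
    have h5 := nrm_ge0 (u n - x).
    have h6 : nrm (u n - x) ^+ 2 <= nrm (u n - x) by rewrite expr2 ler_piMr// ltW.
    have h7 : m * nrm (u n - x) ^+ 2 < m * (e / (2 * m)).
      by rewrite ltr_pM2l//; lra.
    have h8 : m * (e / (2 * m)) = e / 2 by field; rewrite gt_eqF//; lra.
    by rewrite /Q; lra.
  - by move=> i x _; exact: nrm_ge0.
  - by move=> i x y _ _; rewrite /phi innerBl nrmB.
  - by move=> i r x _; rewrite /phi innerZl nrmM nrm_real.
  - move=> i; exists (nrm (sval i).2 ^+ 2) => x Px.
    have := cauchy_schwarz x (sval i).2; rewrite -/(phi i x) => h.
    have : phi i x ^+ 2 <= (nrm x * nrm (sval i).2) ^+ 2.
      by rewrite ler_pXn2r// nnegrE ?mulr_ge0 ?nrm_ge0.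
    move=> h2; apply: le_trans h2 _; rewrite exprMn mulrC.
    by rewrite ler_wpM2l ?sqr_ge0// Qn.
  - move=> x Px; have [w hw] := domB Px; exists (nrm w) => -[[y v] [Byv y1]].
    rewrite /phi /= innerC nrmJ (hw _ _ Byv) /=.
    apply: le_trans (cauchy_schwarz _ _) _.
    by rewrite ler_piMl ?nrm_ge0.
pose C := Num.max K 1; exists m, C; split => //; first by rewrite le_max lexx orbT.
move=> x w Px hw; rewrite -/(ra x x) -/(Q x).
have QC : 0 <= C * Q x by rewrite mulr_ge0 ?Q0// le_max ler01 orbT.
pose r := Num.sqrt (C * Q x).
have r0 : 0 <= r := sqrtr_ge0 _.
have hy y v : B (y, v) -> nrm (inner y w) <= r * nrm y.
  move=> Byv; have [->|y0] := eqVneq y 0.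
    by rewrite linear0l !nrm0 mulr0.
  have ny := nrm_gt0 y0; pose k := (nrm y)^-1%:C.
  have nk : nrm k = (nrm y)^-1 by rewrite nrm_real ger0_norm// invr_ge0 ltW.
  have By : B (k *: y, k *: v).
    have [B0 BP] := subB; have := BP k _ _ Byv B0.
    by rewrite addr0.
  have i1 : nrm (k *: y) <= 1 by rewrite nrmZ nk mulVf// gt_eqF.
  have := hK (exist _ (k *: y, k *: v) (conj By i1)) x Px.
  rewrite /phi /= innerC nrmJ (hw _ _ By) /= innerZl nrmM nk => h.
  rewrite mulrC -ler_pdivrMl// -(@ler_pXn2r _ 2) ?nnegrE//; last first.
    by rewrite mulr_ge0 ?invr_ge0 ?nrm_ge0.
  rewrite sqr_sqrtr//; apply: le_trans h _.
  by rewrite ler_wpM2r ?Q0// le_max lexx.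
(* w need not lie in dom B, so it is replaced by nearby y in dom B. *)
have hww : nrm w ^+ 2 <= r * nrm w.
  apply: (@le_small _ _ _ (r + nrm w)) => e e0.
  have [y [[v Byv] wy]] := dense_nrm denseB w e0.
  have := hy _ _ Byv => h1.
  have h2 := cauchy_schwarz (w - y) w.
  have h3 : nrm w ^+ 2 <= nrm (inner y w) + nrm (inner (w - y) w).
    have <- : nrm (inner w w) = nrm w ^+ 2.
      by rewrite inner_nrm nrm_real ger0_norm// sqr_ge0.
    by rewrite -{1}(subrKC y w) (innerDl y); exact: nrmD.
  have h4 : nrm y <= nrm w + e.
    rewrite -{1}(subKr w y); apply: le_trans (nrmB _ _) _.
    by rewrite lerD2l ltW.
  have h5 : r * nrm y <= r * (nrm w + e) by rewrite ler_wpM2l.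
  have h6 : nrm (w - y) * nrm w <= e * nrm w by rewrite ler_wpM2r ?nrm_ge0// ltW.
  by lra.
rewrite -(sqr_sqrtr QC) -/r ler_pXn2r// ?nnegrE ?nrm_ge0//.
have [w0|w0] := ltP 0 (nrm w); last exact: le_trans r0.
by move: hww; rewrite expr2 ler_pM2r.
Qed.

End RelativeBound.
End Operators.

(** * The symmetric block operator N *)

Section Block.
Context {R : realType} {H1 H2 : hilbertType R}.
Context (A : set (H1 * H1)) (B : set (H2 * H1)) (E : set (H2 * H2)).
Context (self_A : self_adjoint A).
Context (op_B : is_operator B).
Context (self_E : self_adjoint E).
Context (dom_A : dom A `<=` dom (adjoint B)).

(** The operator N before closure. Values are witnesses in the graphs instead of [app], so that
    linear combinations act on the graphs directly. *)
Definition sym_block : set ((H1 * H2) * (H1 * H2)) :=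
  [set p | exists u w v t, [/\ A (p.1.1, u) /\ adjoint B (p.1.1, w),
     B (p.1.2, v), E (p.1.2, t) & p.2 = (u + v, w + t)]].

Lemma sym_block_subspace : is_subspace sym_block.
Proof.
have [[[A0 AP] _] _ _] := self_A; have [[B0 BP] _] := op_B.
have [[[E0 EP] _] _ _] := self_E; have [S0 SP] := adjoint_subspace B.
split; first by exists 0, 0, 0, 0; rewrite !addr0.
move=> c p q [u [w [v [t [[Au Sw] Bv Et pE]]]]] [u' [w' [v' [t' [[Au' Sw'] Bv' Et' qE]]]]].
exists (c *: u + u'), (c *: w + w'), (c *: v + v'), (c *: t + t'); split.
- by split; [exact: (AP c _ _ Au Au')|exact: (SP c _ _ Sw Sw')].
- exact: (BP c _ _ Bv Bv').
- exact: (EP c _ _ Et Et').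
- by rewrite /= pE qE; congr pair; rewrite /= scalerDr addrACA.
Qed.

Lemma sym_block_symmetric p q :
  sym_block p -> sym_block q -> pip p.2 q.1 = pip p.1 q.2.
Proof.
have [_ _ adjA] := self_A; have [_ _ adjE] := self_E.
have rA x u y v : A (x, u) -> A (y, v) -> rip u y = rip x v.
  by rewrite -{2}adjA /rip => h /(_ _ _ h) /= ->.
have rE x u y v : E (x, u) -> E (y, v) -> rip u y = rip x v.
  by rewrite -{2}adjE /rip => h /(_ _ _ h) /= ->.
have rB x u y v : B (x, u) -> adjoint B (y, v) -> rip u y = rip x v.
  by rewrite /rip => h /(_ _ _ h) /= ->.
move=> [u [w [v [t [[Au Sw] Bv Et ->]]]]] [u' [w' [v' [t' [[Au' Sw'] Bv' Et' ->]]]]].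
have h1 := @rip_inner _ H1; have h2 := @rip_inner _ H2.
rewrite /pip /= !(ripDl h1, ripDl h2, ripDr h1, ripDr h2).
rewrite (rA _ _ _ _ Au Au') (rE _ _ _ _ Et Et') (rB _ _ _ _ Bv Sw').
by rewrite (ripC h2 w) -(rB _ _ _ _ Bv' Sw) (ripC h1 v'); lra.
Qed.

(** Allows an element of N to be paired with a solution that is only found in the closure of N. *)
Lemma closure_symmetric (T : set ((H1 * H2) * (H1 * H2))) :
  (forall p q, T p -> T q -> pip p.2 q.1 = pip p.1 q.2) ->
  forall p q, T p -> closure T q -> pip p.2 q.1 = pip p.1 q.2.
Proof.
move=> symT p q Tp /closure_nrmP hq; have hp := @pip_inner _ H1 H2.
have bound (x y : H1 * H2) : `|pip x y| <= 2 * nrm x * nrm y.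
  have := rip_cauchy_schwarz hp x y.
  have := rip_le hp x; have := rip_le hp y; have := nrm_ge0 x; have := nrm_ge0 y.
  have := rip_ge0 hp x; have := rip_ge0 hp y => yy xx ny nx hy hx h.
  have hxy : pip x x * pip y y <= (2 * nrm x ^+ 2) * (2 * nrm y ^+ 2) by rewrite ler_pM.
  have e0 : 0 <= 2 * nrm x * nrm y by rewrite mulr_ge0// mulr_ge0.
  by apply: (norm_le_sqr e0); rewrite !exprMn; lra.
apply/eqP; rewrite -subr_eq0 -normr_le0.
apply: (@le_small _ _ _ (2 * nrm p.2 + 2 * nrm p.1)) => e /hq[q' [Tq']].
rewrite nrm_pair_lt /= => /andP[e1 e2]; rewrite add0r.
have -> : pip p.2 q.1 - pip p.1 q.2 = pip p.2 (q.1 - q'.1) - pip p.1 (q.2 - q'.2).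
  by rewrite !(ripBr hp) (symT _ _ Tp Tq'); lra.
apply: le_trans (ler_normB _ _) _; rewrite mulrDl; apply: lerD.
  by apply: le_trans (bound _ _) _; rewrite ler_wpM2l ?mulr_ge0 ?nrm_ge0// ltW.
by apply: le_trans (bound _ _) _; rewrite ler_wpM2l ?mulr_ge0 ?nrm_ge0// ltW.
Qed.

Context (qa : H1 -> R) (C m cE : R).
Context (C1 : 1 <= C).
Context (qaE : forall x u, A (x, u) -> qa x = rip u x).
Context (qa_ge : forall x, dom A x -> nrm x ^+ 2 <= qa x + m * nrm x ^+ 2).
Context (adjB_le : forall x w, dom A x -> adjoint B (x, w) ->
  nrm w ^+ 2 <= C * (qa x + m * nrm x ^+ 2)).
Context (low_E : lower_bound_op E cE).
Context (core_E : forall p, E p ->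
  closure [set p | E p /\ dom B p.1] p).

(** With w = B^* x, -2 Re <y, w> <= |w|^2 / C + C |y|^2, and |w|^2 / C is absorbed by a[x] + m
    |x|^2. The two bounds on mu then leave N - mu >= 1 as a form. The factor 2 compares [pip] with
    the max norm. *)
Lemma sym_block_lower (mu : R) : mu <= - m - 1 -> mu <= cE - C - 1 ->
  forall h l, sym_block (h, l) -> nrm h <= 2 * nrm (l - mu%:C *: h).
Proof.
have c1 := C1; move=> mu1 mu2 [x y] l [u [w [v [t [/= [Au Sw] Bv Et ->]]]]].
have hp := @pip_inner _ H1 H2; have h1 := @rip_inner _ H1; have h2 := @rip_inner _ H2.
set h := (x, y); set k := _ - _.
have hk : pip h h <= pip k h.
  have -> : pip k h = rip u x + rip v x + (rip w y + rip t y)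
      - mu * (nrm x ^+ 2 + nrm y ^+ 2).
    rewrite /k (ripBl hp) (ripZl hp) /pip /= (ripDl h1) (ripDl h2).
    by rewrite !rip_nrm.
  rewrite /pip /= !rip_nrm -(qaE Au) (ripC h2 w).
  have -> : rip v x = rip y w by rewrite /rip (Sw _ _ Bv).
  have dx : dom A x by exists u.
  have a1 := adjB_le dx Sw; have a2 := qa_ge dx.
  have a3 := lower_bound_rip low_E Et.
  have a4 : - (2 * rip y w) <= nrm w ^+ 2 / C + C * nrm y ^+ 2.
    have := rip_le_nrm (- y) w; rewrite (ripNl h2) nrmN => b1.
    have b2 : 0 <= (nrm w - C * nrm y) ^+ 2 / C.
      by rewrite divr_ge0 ?sqr_ge0//; lra.
    have b3 : (nrm w - C * nrm y) ^+ 2 / C =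
        nrm w ^+ 2 / C + C * nrm y ^+ 2 - 2 * (nrm y * nrm w).
      by field; rewrite gt_eqF//; lra.
    by lra.
  have a5 : nrm w ^+ 2 / C <= qa x + m * nrm x ^+ 2.
    by rewrite ler_pdivrMr; [rewrite mulrC|lra].
  have a6 : (m + 1 + mu) * nrm x ^+ 2 <= 0 by rewrite mulr_le0_ge0 ?sqr_ge0//; lra.
  have a7 : (mu - cE + C + 1) * nrm y ^+ 2 <= 0 by rewrite mulr_le0_ge0 ?sqr_ge0//; lra.
  by rewrite !mulrDl mulNr in a6 a7; lra.
have hh := rip_ge0 hp h.
have kk : pip h h <= pip k k.
  have cs := rip_cauchy_schwarz hp k h.
  have [h0|h0] := ltP 0 (pip h h); last exact: le_trans (rip_ge0 hp k).
  by rewrite -(ler_pM2r h0); apply: le_trans cs; rewrite -expr2; exact: sqr_le_sqr.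
have := rip_ge hp h; have := rip_le hp k => b1 b2.
have k0 : 0 <= 2 * nrm k by rewrite mulr_ge0// nrm_ge0.
rewrite -(ger0_norm (nrm_ge0 h)); apply: (norm_le_sqr k0); rewrite exprMn.
by have := sqr_ge0 (nrm k); lra.
Qed.

(* For y in the core, rip v f = - rip w g with x = (A - mu)^-1 v and w = B^* x,
   so that g is almost orthogonal to the range of E - mu; here
   nrm w <= C * nrm y because nrm w ^+ 2 <= C * rip v x = C * rip y w. *)
Lemma sym_block_trivial_orthogonal (mu : R) : mu <= - m - 1 -> mu <= cE - C - 1 ->
  (exists2 c, lower_bound_op A c & mu < c) ->
  forall k, (forall h l, sym_block (h, l) -> pip (l - mu%:C *: h) k = 0) -> k = 0.
Proof.
have c1 := C1; move=> mu1 mu2 [c lA muc] [f g] hk.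
have hp := @pip_inner _ H1 H2; have h1 := @rip_inner _ H1; have h2 := @rip_inner _ H2.
have [[[A0 AP] _] _ _] := self_A; have [[B0 BP] _] := op_B.
have [[[E0 EP] _] _ _] := self_E; have [S0 SP] := adjoint_subspace B.
have [surjA _] := self_adjoint_resolvent self_A lA muc.
have muE : mu < cE by lra.
have [surjE _] := self_adjoint_resolvent self_E low_E muE.
have eq1 x u w : A (x, u) -> adjoint B (x, w) -> rip (u - mu%:C *: x) f = - rip w g.
  move=> Au Sw; have /hk : sym_block ((x, 0), (u, w)).
    by exists u, w, 0, 0; split => //=; rewrite !addr0.
  rewrite (ripBl hp) (ripZl hp) /pip /= (ripBl h1) (ripZl h1).
  have -> : rip (0 : H2) g = 0 by rewrite /rip linear0l.
  by move=> h; lra.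
have eq2 y v t : B (y, v) -> E (y, t) -> rip v f = - rip (t - mu%:C *: y) g.
  move=> Bv Et; have /hk : sym_block ((0, y), (v, t)).
    by exists 0, 0, v, t; split => //=; rewrite !add0r.
  rewrite (ripBl hp) (ripZl hp) /pip /= (ripBl h2) (ripZl h2).
  have -> : rip (0 : H1) f = 0 by rewrite /rip linear0l.
  by move=> h; lra.
have core y t : E (y, t) -> dom B y ->
    rip (t - mu%:C *: y) g <= C * nrm y * nrm g.
  move=> Et [v Bv]; have [x [Ax _]] := surjA v.
  have dx : dom A x by exists (v + mu%:C *: x).
  have [w Sw] := dom_A dx.
  have e1 := eq1 _ _ _ Ax Sw; rewrite addrK in e1; have e2 := eq2 _ _ _ Bv Et.
  have -> : rip (t - mu%:C *: y) g = rip w g by lra.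
  apply: le_trans (rip_le_nrm _ _) _; rewrite ler_wpM2r ?nrm_ge0//.
  have a1 := adjB_le dx Sw.
  have a2 : qa x + m * nrm x ^+ 2 <= rip v x.
    rewrite (qaE Ax) (ripDl h1) (ripZl h1) rip_nrm.
    have : (mu + m) * nrm x ^+ 2 <= 0 by rewrite mulr_le0_ge0 ?sqr_ge0//; lra.
    by rewrite mulrDl; lra.
  have a3 : rip v x = rip y w by rewrite /rip (Sw _ _ Bv).
  have a4 := rip_le_nrm y w.
  have a5 : C * (qa x + m * nrm x ^+ 2) <= C * (nrm y * nrm w).
    by rewrite ler_wpM2l; lra.
  have [w0|w0] := ltP 0 (nrm w).
    by rewrite -(ler_pM2r w0) -expr2 -mulrA; lra.
  by apply: le_trans w0 _; rewrite mulr_ge0 ?nrm_ge0//; lra.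
(* Both sides are continuous in the graph norm of E, so the estimate extends from the core. *)
have all_E y t : E (y, t) -> rip (t - mu%:C *: y) g <= C * nrm y * nrm g.
  move=> /core_E /closure_nrmP h.
  apply: (@le_small _ _ _ ((1 + `|mu| + C) * nrm g)) => e /h[[y' t'] [[Et' By']]].
  rewrite nrm_pair_lt /= => /andP[yy tt].
  have := core _ _ Et' By' => a1.
  have a2 : nrm y' <= nrm y + e.
    rewrite -{1}(subKr y y'); apply: le_trans (nrmB _ _) _.
    by rewrite lerD2l ltW.
  have -> : t - mu%:C *: y = (t' - mu%:C *: y') + ((t - t') - mu%:C *: (y - y')).
    by rewrite graph_sub subrKC.
  rewrite (ripDl h2).
  have a3 := rip_le_nrm ((t - t') - mu%:C *: (y - y')) g.
  have a4 : nrm ((t - t') - mu%:C *: (y - y')) <= e + `|mu| * e.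
    apply: le_trans (nrmB _ _) _; rewrite nrmZ nrm_real; apply: lerD; first exact: ltW.
    by rewrite ler_wpM2l// ltW.
  have a5 : nrm ((t - t') - mu%:C *: (y - y')) * nrm g <= (e + `|mu| * e) * nrm g.
    by rewrite ler_wpM2r ?nrm_ge0.
  have a6 : C * nrm y' * nrm g <= C * (nrm y + e) * nrm g.
    by rewrite ler_wpM2r ?nrm_ge0// ler_wpM2l//; lra.
  have -> : C * nrm y * nrm g + (1 + `|mu| + C) * nrm g * e =
    C * (nrm y + e) * nrm g + (e + `|mu| * e) * nrm g by ring.
  by lra.
(* For y = (E - mu)^-1 g the estimate reads |g|^2 <= C |y| |g|, whereas |g| >= (cE - mu) |y| with cE
   - mu > C. *)
have g0 : g = 0.
  have [y [Ey _]] := surjE g.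
  have a1 := all_E _ _ Ey; have a2 := lower_bound_resolvent mu low_E Ey.
  rewrite addrK rip_nrm in a1 a2.
  apply: nrm_le0; rewrite leNgt; apply/negP => ng.
  rewrite expr2 ler_pM2r// in a1.
  have : 0 <= nrm y := nrm_ge0 y.
  rewrite le_eqVlt => /orP[/eqP y0|y0]; first by rewrite -y0 mulr0 in a1; lra.
  have : C * nrm y < (cE - mu) * nrm y by rewrite ltr_pM2r//; lra.
  by lra.
(* As g = 0, the choice x = (A - mu)^-1 f turns [eq1] into |f|^2 = 0. *)
have f0 : f = 0.
  have [x [Ax _]] := surjA f.
  have [w Sw] := dom_A (ex_intro (fun u => A (x, u)) _ Ax).
  have := eq1 _ _ _ Ax Sw; rewrite addrK rip_nrm g0 /rip linear0r oppr0 => /eqP.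
  by rewrite sqrf_eq0 => /eqP /nrm_eq0.
by rewrite f0 g0.
Qed.

End Block.

(** * Determinant bounds for the matrices of the quadratic numerical range *)

Section QuadraticNumericalRange.
Context {R : realType}.

(** To be read with p = |al - z|, r = |de - z|, k = |be| and De = |det (M_xy - z)|. If r <= R0, then
    p <= R0 + 2 De / ep, and constants cost De / ep^2. If r > R0 and p < 1, then r <= 1 + 2 De / ep.
    If r > R0 and p >= 1, then k^2 <= C (1 + L) p <= p r / 2, so p r <= 2 De. *)
Lemma bounded_of_dichotomy (ep C L : R) : 0 < ep -> 1 <= C -> 0 <= L ->
  exists2 K : R, 0 <= K & forall p r k De : R, 0 <= p -> 0 <= r -> 0 <= k ->
    k ^+ 2 <= C * (p + L) -> ep ^+ 2 <= De -> ep * (p - r) <= 2 * De ->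
    ep * (r - p) <= 2 * De -> p * r - k ^+ 2 <= De -> p + r + 2 * k <= K * De.
Proof.
move=> ep0 C1 L0; pose R0 := 2 * C * (1 + L) + 4.
have CL : 0 <= C * L by rewrite mulr_ge0//; lra.
have R04 : 4 <= R0 by rewrite /R0; lra.
pose iv := ep^-1; have iv0 : 0 < iv by rewrite invr_gt0.
have ive : iv * ep = 1 by rewrite mulVf// gt_eqF.
(* The first two terms serve r <= R0, the 6 serves p >= 1 and 8 iv serves p < 1. *)
pose M := 2 * iv + (2 * R0 + 1) * iv ^+ 2 + 6 + 8 * iv.
have iv2 : 0 <= (2 * R0 + 1) * iv ^+ 2 by rewrite mulr_ge0 ?sqr_ge0//; lra.
have M0 : 0 <= M by rewrite /M; lra.
have CC : 0 <= 1 + C + C * L by lra.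
(* The first factor absorbs 2 k <= 1 + k^2 <= 1 + C (p + L). *)
exists ((1 + C + C * L) * M); first exact: mulr_ge0.
move=> p r k De p0 r0 k0 hk d1 d2 d3 d4.
have De0 : 0 <= De by apply: le_trans d1; rewrite sqr_ge0.
have one : 1 <= iv ^+ 2 * De.
  have : iv ^+ 2 * ep ^+ 2 <= iv ^+ 2 * De by rewrite ler_wpM2l// sqr_ge0.
  by rewrite -exprMn ive expr1n.
have i2 : p - r <= 2 * (iv * De).
  have : iv * (ep * (p - r)) <= iv * (2 * De) by rewrite ler_wpM2l// ltW.
  by rewrite (mulrA iv ep) ive mul1r; lra.
have i3 : r - p <= 2 * (iv * De).
  have : iv * (ep * (r - p)) <= iv * (2 * De) by rewrite ler_wpM2l// ltW.
  by rewrite (mulrA iv ep) ive mul1r; lra.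
have ivD : 0 <= iv * De by rewrite mulr_ge0// ltW.
have iv2D : 0 <= iv ^+ 2 * De by rewrite mulr_ge0// sqr_ge0.
have R0D : 0 <= (2 * R0 + 1) * (iv ^+ 2 * De) by rewrite mulr_ge0//; lra.
have ME : M * De = 2 * (iv * De) + (2 * R0 + 1) * (iv ^+ 2 * De) + 6 * De
    + 8 * (iv * De) by rewrite /M; ring.
have main : p + r + 1 <= M * De.
  rewrite ME; have [rR|Rr] := leP r R0.
    have : (2 * R0 + 1) * 1 <= (2 * R0 + 1) * (iv ^+ 2 * De) by rewrite ler_wpM2l//; lra.
    by lra.
  have [p1|p1] := leP 1 p; last by lra.
  have hp : 0 <= (p - 1) * (C * L) by rewrite mulr_ge0//; lra.
  have hr : C * (1 + L) + 2 < r - C * (1 + L) by move: Rr; rewrite /R0; lra.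
  have h1 : 0 <= (r - C * (1 + L) - r / 2) * p by rewrite mulr_ge0//; lra.
  have h2 : 0 <= (p - 1) * (r - 1) by rewrite mulr_ge0//; lra.
  have h3 : 0 <= (p - 1) * r by rewrite mulr_ge0//; lra.
  have h4 : 0 <= p * (r - 1) by rewrite mulr_ge0//; lra.
  by lra.
have k2 : 2 * k <= 1 + k ^+ 2 by have := sqr_ge0 (k - 1); rewrite !expr2; lra.
have a1 : 0 <= (1 + C + C * L) * (M * De - (p + r + 1)).
  by rewrite mulr_ge0//; lra.
have a2 : 0 <= C * r by rewrite mulr_ge0//; lra.
have a3 : 0 <= C * L * r by rewrite mulr_ge0.
have a4 : 0 <= C * L * p by rewrite mulr_ge0.
have a5 : 0 <= C * p by rewrite mulr_ge0//; lra.
rewrite -mulrA; lra.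
Qed.

(** Characteristic equation of the matrix with rows (al, be) and (-conj be, de). *)
Definition is_qnr_root (al de : R) (be la : R[i]) : Prop :=
  (al%:C - la) * (de%:C - la) + be * conjc be = 0.

(** The coefficients al + de and al de + |be|^2 of the equation are real. *)
Lemma qnr_rootJ al de be la : is_qnr_root al de be la ->
  is_qnr_root al de be (conjc la).
Proof.
have cD (c e : R[i]) : conjc (c + e) = conjc c + conjc e := rmorphD _ c e.
have cB (c e : R[i]) : conjc (c - e) = conjc c - conjc e := rmorphB _ c e.
have cM (c e : R[i]) : conjc (c * e) = conjc c * conjc e := rmorphM _ c e.
rewrite /is_qnr_root => /(congr1 conjc).
by rewrite cD !cM !cB !realcJ conjcK [conjc be * _]mulrC => ->.
Qed.

Lemma qnr_root_eigenvalue al de be la : is_qnr_root al de be la ->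
  eigenvalue (block_mx al%:C%:M be%:M (- conjc be)%:M de%:C%:M : 'M[R[i]]_(1 + 1)) la.
Proof.
move=> root_la.
have vE (p q : R[i]) : p * al%:C - q * conjc be = la * p -> p * be + q * de%:C = la * q ->
    (p != 0) || (q != 0) ->
    eigenvalue (block_mx al%:C%:M be%:M (- conjc be)%:M de%:C%:M : 'M[R[i]]_(1 + 1)) la.
  move=> e1 e2 pq; apply/eigenvalueP; exists (row_mx p%:M q%:M : 'rV_(1 + 1)).
    rewrite mul_row_block -!scalar_mxM -!raddfD /= mulrN e1 e2.
    by rewrite scale_row_mx !scale_scalar_mx.
  have scalar_eq0 (c : R[i]) : (c%:M == 0 :> 'M[R[i]]_1) = (c == 0).
    apply/eqP/eqP => [/matrixP/(_ 0 0)|->]; last exact: raddf0.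
    by rewrite !mxE.
  by rewrite row_mx_eq0 negb_and !scalar_eq0.
have [be0|be0] := eqVneq be 0; last first.
  (* Eigenvectors are rows: (la - de, be) satisfies the second equation identically and the first by
     the characteristic equation. *)
  apply: (vE (la - de%:C) be); last by rewrite be0 orbT.
  - by apply/eqP; rewrite -subr_eq0 -[X in _ == X]oppr0 -root_la; apply/eqP; ring.
  - by ring.
have /eqP : (al%:C - la) * (de%:C - la) = 0.
  by move: root_la; rewrite /is_qnr_root be0 mul0r addr0.
have n10 : (1 : R[i]) != 0 := oner_neq0 _.
rewrite mulf_eq0 !subr_eq0 => /orP[/eqP alE|/eqP deE].
  refine (vE 1 0 _ _ _).
  - by rewrite mul0r subr0 mulrC alE.
  - by rewrite be0 mul0r !mulr0 addr0.
  - by rewrite n10.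
refine (vE 0 1 _ _ _).
- by rewrite be0 mul0r !mulr0 mul1r sub0r conjc0 oppr0.
- by rewrite mul0r add0r mulrC deE.
- by rewrite n10 orbT.
Qed.

(** For the roots l1, l2, the numbers l1 - z and l2 - z have the determinant as product and the
    trace of M_xy - z as sum. As both have modulus at least ep, |l1 - z| + |l2 - z| <= 2 De / ep,
    and the trace bounds the difference of |al - z| and |de - z|. *)
Lemma qnr_det_bound (z : R[i]) (ep C L : R) : 0 < ep -> 1 <= C ->
  exists2 K : R, 0 <= K & forall (al de : R) (be : R[i]),
    nrm be ^+ 2 <= C * (al + L) ->
    (forall la, is_qnr_root al de be la -> ep <= nrm (la - z)) ->
    let De := nrm ((al%:C - z) * (de%:C - z) + be * conjc be) in
    0 < De /\
    nrm (al%:C - z) + nrm (de%:C - z) + 2 * nrm be <= K * De.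
Proof.
move=> ep0 C1.
(* This shift turns the bound on |be|^2 in terms of al into one in terms of |al - z|. *)
have LL : 0 <= `|L| + nrm z by rewrite addr_ge0// nrm_ge0.
have [K K0 hK] := bounded_of_dichotomy ep0 C1 LL; exists K => // al de be hbe hroot.
set De := nrm _.
pose s := sqrtc ((al%:C - de%:C) ^+ 2 / 4 - be * conjc be).
have s2 : s ^+ 2 = (al%:C - de%:C) ^+ 2 / 4 - be * conjc be := sqr_sqrtc _.
pose l1 := (al%:C + de%:C) / 2 + s; pose l2 := (al%:C + de%:C) / 2 - s.
have r1 : is_qnr_root al de be l1.
  rewrite /is_qnr_root.
  have -> : (al%:C - l1) * (de%:C - l1) = s ^+ 2 - (al%:C - de%:C) ^+ 2 / 4.
    by rewrite /l1; field.
  by rewrite s2; ring.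
have r2 : is_qnr_root al de be l2.
  rewrite /is_qnr_root.
  have -> : (al%:C - l2) * (de%:C - l2) = s ^+ 2 - (al%:C - de%:C) ^+ 2 / 4.
    by rewrite /l2; field.
  by rewrite s2; ring.
have n1 := hroot _ r1; have n2 := hroot _ r2.
have DeE : De = nrm (l1 - z) * nrm (l2 - z).
  rewrite /De -nrmM; congr nrm.
  have -> : (l1 - z) * (l2 - z) = ((al%:C + de%:C) / 2 - z) ^+ 2 - s ^+ 2.
    by rewrite /l1 /l2; ring.
  by rewrite s2; field.
have sumE : (l1 - z) + (l2 - z) = (al%:C - z) + (de%:C - z).
  by rewrite /l1 /l2; field.
have tri : nrm ((al%:C - z) + (de%:C - z)) <= nrm (l1 - z) + nrm (l2 - z).
  by rewrite -sumE; exact: nrmD.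
have t1 : nrm (al%:C - z) - nrm (de%:C - z) <= nrm ((al%:C - z) + (de%:C - z)).
  have := nrmB ((al%:C - z) + (de%:C - z)) (de%:C - z).
  by rewrite addrK; lra.
have t2 : nrm (de%:C - z) - nrm (al%:C - z) <= nrm ((al%:C - z) + (de%:C - z)).
  have := nrmB ((al%:C - z) + (de%:C - z)) (al%:C - z).
  by rewrite [X in nrm (X - _)]addrC addrK; lra.
have p1 : 0 <= (nrm (l1 - z) - ep) * nrm (l2 - z) by rewrite mulr_ge0 ?nrm_ge0//; lra.
have p2 : 0 <= (nrm (l2 - z) - ep) * nrm (l1 - z) by rewrite mulr_ge0 ?nrm_ge0//; lra.
have p3 : 0 <= (nrm (l2 - z) - ep) * ep by rewrite mulr_ge0//; lra.
have De2 : ep ^+ 2 <= De by rewrite DeE expr2; lra.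
split; first by apply: lt_le_trans De2; rewrite exprn_gt0.
apply: hK => //; rewrite ?nrm_ge0//.
- apply: le_trans hbe _; rewrite ler_wpM2l//; first lra.
  have : al <= nrm (al%:C - z) + nrm z.
    apply: le_trans (nrmD _ _); rewrite subrK nrm_real; exact: ler_norm.
  by have := ler_norm L; lra.
- have : ep * (nrm (al%:C - z) - nrm (de%:C - z)) <= ep * (nrm (l1 - z) + nrm (l2 - z)).
    by rewrite ler_pM2l//; lra.
  by rewrite DeE; lra.
- have : ep * (nrm (de%:C - z) - nrm (al%:C - z)) <= ep * (nrm (l1 - z) + nrm (l2 - z)).
    by rewrite ler_pM2l//; lra.
  by rewrite DeE; lra.
rewrite -nrmM.
have -> : nrm be ^+ 2 = nrm (be * conjc be) by rewrite nrmM nrmJ expr2.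
rewrite lerBlDr; apply: le_trans (nrmB _ (be * conjc be)).
by rewrite addrK.
Qed.

End QuadraticNumericalRange.

(** * Lower bound for M - z away from the quadratic numerical range *)

Section LowerBound.
Context {R : realType} {H1 H2 : hilbertType R}.

(** Pairing the components of (M - z) (x, y) with x / |x| and y / |y| gives (e1, e2) = (M_xy - z)
    (|x|, |y|), where |e1| and |e2| are at most the norms of the components; Cramer's rule solves
    for |x| and |y|. *)
Lemma qnr_lower (x u : H1) (w : H2) (y t : H2) (v : H1) (z : R[i]) (K : R) :
  inner u x = (rip u x)%:C -> inner t y = (rip t y)%:C ->
  inner v x = inner y w -> x != 0 -> y != 0 -> 0 <= K ->
  let al := rip u x / nrm x ^+ 2 in
  let de := - rip t y / nrm y ^+ 2 in
  let be := inner y w / (nrm x * nrm y)%:C in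
  let De := nrm ((al%:C - z) * (de%:C - z) + be * conjc be) in
  0 < De -> nrm (al%:C - z) + nrm (de%:C - z) + 2 * nrm be <= K * De ->
  nrm (x, y) <= 2 * K * nrm ((u + v, - (w + t)) - z *: (x, y)).
Proof.
move=> ux ty vx x0 y0 K0 al de be De De0 hK.
have s0 := nrm_gt0 x0; have q0 := nrm_gt0 y0.
set s := nrm x in al be De De0 hK s0 *; set q := nrm y in de be De De0 hK q0 *.
have sC : s%:C != 0 by rewrite -(rmorph0 (real_complex R)) (inj_eq (@complexI R)) gt_eqF.
have qC : q%:C != 0 by rewrite -(rmorph0 (real_complex R)) (inj_eq (@complexI R)) gt_eqF.
pose f1 := u + v - z *: x; pose f2 := - (w + t) - z *: y.
pose e1 := inner f1 x / s%:C; pose e2 := inner f2 y / q%:C.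
have xx : inner x x = s%:C ^+ 2 by rewrite inner_nrm rmorphXn.
have yy : inner y y = q%:C ^+ 2 by rewrite inner_nrm rmorphXn.
have uE : inner u x = al%:C * s%:C ^+ 2.
  by rewrite ux -rmorphXn -rmorphM /= /al divfK// gt_eqF// exprn_gt0.
have tE : inner t y = - (de%:C * q%:C ^+ 2).
  rewrite ty -rmorphXn -rmorphM -rmorphN /= /de mulNr mulNr opprK divfK//.
  by rewrite gt_eqF// exprn_gt0.
have bE : inner y w = be * (s%:C * q%:C).
  by rewrite /be rmorphM /= divfK// mulf_neq0.
have cM (c e : R[i]) : conjc (c * e) = conjc c * conjc e := rmorphM _ c e.
have wE : inner w y = conjc be * (s%:C * q%:C) by rewrite innerC bE !cM !realcJ.
have e1E : e1 = (al%:C - z) * s%:C + be * q%:C.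
  rewrite /e1 /f1 innerBl innerDl innerZl uE vx bE xx.
  by field.
have e2E : e2 = - conjc be * s%:C + (de%:C - z) * q%:C.
  rewrite /e2 /f2 innerBl innerNl innerDl innerZl tE wE yy.
  by field.
have ne1 : nrm e1 <= nrm f1.
  rewrite /e1 nrmM nrmV nrm_real gtr0_norm//.
  by rewrite ler_pdivrMr// cauchy_schwarz.
have ne2 : nrm e2 <= nrm f2.
  rewrite /e2 nrmM nrmV nrm_real gtr0_norm//.
  by rewrite ler_pdivrMr// cauchy_schwarz.
clearbody e1 e2.
pose d := (al%:C - z) * (de%:C - z) + be * conjc be.
have DeE : De = nrm d by [].
clearbody De; clearbody al de be.
have dq : De * q <= nrm (al%:C - z) * nrm e2 + nrm be * nrm e1.
  have -> : De * q = nrm (d * q%:C) by rewrite DeE nrmM nrm_real gtr0_norm.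
  have -> : d * q%:C = (al%:C - z) * e2 + conjc be * e1 by rewrite e1E e2E /d; ring.
  by apply: le_trans (nrmD _ _) _; rewrite !nrmM nrmJ.
have ds : De * s <= nrm (de%:C - z) * nrm e1 + nrm be * nrm e2.
  have -> : De * s = nrm (d * s%:C) by rewrite DeE nrmM nrm_real gtr0_norm.
  have -> : d * s%:C = (de%:C - z) * e1 - be * e2 by rewrite e1E e2E /d; ring.
  by apply: le_trans (nrmB _ _) _; rewrite !nrmM.
have fE : (u + v, - (w + t)) - z *: (x, y) = (f1, f2) by [].
rewrite fE; set N := nrm (f1, f2).
have N1 : nrm f1 <= N by rewrite /N nrm_pair le_max lexx.
have N2 : nrm f2 <= N by rewrite /N nrm_pair le_max lexx orbT.
have N0 : 0 <= N by exact: nrm_ge0.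
have b1 : nrm (al%:C - z) * nrm e2 <= nrm (al%:C - z) * N.
  by rewrite ler_wpM2l ?nrm_ge0// (le_trans ne2).
have b2 : nrm be * nrm e1 <= nrm be * N by rewrite ler_wpM2l ?nrm_ge0// (le_trans ne1).
have b3 : nrm (de%:C - z) * nrm e1 <= nrm (de%:C - z) * N.
  by rewrite ler_wpM2l ?nrm_ge0// (le_trans ne1).
have b4 : nrm be * nrm e2 <= nrm be * N by rewrite ler_wpM2l ?nrm_ge0// (le_trans ne2).
have b5 : (nrm (al%:C - z) + nrm (de%:C - z) + 2 * nrm be) * N <= K * De * N.
  by rewrite ler_wpM2r.
have b6 : De * (s + q) <= De * (K * N) by lra.
rewrite ler_pM2l// in b6.
have KN : 0 <= K * N by rewrite mulr_ge0.
have : nrm (x, y) <= s + q.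
  by rewrite nrm_pair /= ge_max -/s -/q lerDl lerDr !ltW.
by rewrite -mulrA; lra.
Qed.

Context (A : set (H1 * H1)) (B : set (H2 * H1)) (E : set (H2 * H2)).
Context (self_A : self_adjoint A).
Context (op_B : is_operator B).
Context (self_E : self_adjoint E).
Context (dom_A : dom A `<=` dom (adjoint B)).
Context (core_E : forall p, E p -> closure [set p | E p /\ dom B p.1] p).
Context (qa : H1 -> R) (C m : R).
Context (C1 : 1 <= C).
Context (qaE : forall x u, A (x, u) -> qa x = rip u x).
Context (adjB_le : forall x w, dom A x -> adjoint B (x, w) ->
  nrm w ^+ 2 <= C * (qa x + m * nrm x ^+ 2)).

(** Vectors are taken from the operator domains, where the forms are inner products; t = E y = - D y
    explains the sign of the second diagonal entry. *)
Definition qnr_separated (z : R[i]) (ep : R) := forall x u w y t la,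
  A (x, u) -> adjoint B (x, w) -> E (y, t) -> x != 0 -> y != 0 ->
  is_qnr_root (rip u x / nrm x ^+ 2) (- rip t y / nrm y ^+ 2)
    (inner y w / (nrm x * nrm y)%:C) la -> ep <= nrm (la - z).

Lemma qnr_separatedJ z ep : qnr_separated z ep -> qnr_separated (conjc z) ep.
Proof.
move=> h x u w y t la Au Sw Et x0 y0 /qnr_rootJ /(h _ _ _ _ _ _ Au Sw Et x0 y0).
have cB (c e : R[i]) : conjc (c - e) = conjc c - conjc e := rmorphB _ c e.
by rewrite -nrmJ cB conjcK.
Qed.

Lemma self_adjoint_real (H : hilbertType R) (T : set (H * H)) x u :
  self_adjoint T -> T (x, u) -> inner u x = (rip u x)%:C.
Proof.
move=> [_ _ adjT] Txu; have : adjoint T (x, u) by rewrite adjT.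
move=> /(_ _ _ Txu) /=; rewrite [inner x u]innerC /rip.
by case: (inner u x) => p q [] /eqP; rewrite -addr_eq0 -mulr2n mulrn_eq0 => /= /eqP ->.
Qed.

(** One b serves every e: the direction x0 is added only when x = 0. *)
Lemma perturb (H : hilbertType R) (x x0 : H) : x0 != 0 ->
  exists b : bool, forall e : R, 0 < e -> x + e%:C *: (b%:R *: x0) != 0.
Proof.
move=> n0; exists (x == 0) => e e0; have [->|x1] := eqVneq x 0.
  rewrite add0r scale1r scaler_eq0 negb_or n0 andbT.
  by rewrite -(rmorph0 (real_complex R)) (inj_eq (@complexI R)) gt_eqF.
by rewrite scale0r scaler0 addr0.
Qed.

Lemma dense_nontrivial (H : hilbertType R) (S : set H) : dense S ->
  exists x, S x /\ x != 0.
Proof.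
move=> dS; have [x x0] := hilbert_nontrivial H.
have [y [Sy xy]] := dense_nrm dS x (nrm_gt0 x0).
exists y; split => //; apply/eqP => y0.
by move: xy; rewrite y0 subr0 ltxx.
Qed.

(** A nonzero vector of dom E may lie outside dom B; a core vector closer to it than its norm is
    still nonzero. *)
Lemma sym_block_nontrivial : exists x u w y v t,
  [/\ x != 0, y != 0, A (x, u) /\ adjoint B (x, w) & B (y, v) /\ E (y, t)].
Proof.
have [_ dA _] := self_A; have [_ dE _] := self_E.
have [x [[u Au] x0]] := dense_nontrivial dA.
have [w Sw] := dom_A (ex_intro (fun u => A (x, u)) _ Au).
have [y1 [[t1 Et1] y10]] := dense_nontrivial dE.
have [[y t] [[Et [v Bv]]]] := (closure_nrmP _ _).1 (core_E Et1) _ (nrm_gt0 y10).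
rewrite nrm_pair_lt /= => /andP[yy _].
exists x, u, w, y, v, t; split => //.
by apply/eqP => y0; move: yy; rewrite y0 subr0 ltxx.
Qed.

(* The quadratic numerical range only sees pairs (x, y) with x != 0 and y != 0;
   the other pairs are reached by perturbation. *)
Lemma sym_block_lower_separated z ep : 0 < ep -> qnr_separated z ep ->
  exists2 K : R, 0 <= K & forall p, sym_block A B E p ->
    nrm p.1 <= K * nrm ((p.2.1, - p.2.2) - z *: p.1).
Proof.
move=> ep0 sep; have c1 := C1.
have [K K0 hK] := qnr_det_bound z m ep0 C1.
have K20 : 0 <= 2 * K by rewrite mulr_ge0.
exists (2 * K) => //.
have generic p : sym_block A B E p -> p.1.1 != 0 -> p.1.2 != 0 ->
    nrm p.1 <= 2 * K * nrm ((p.2.1, - p.2.2) - z *: p.1).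
  move: p => [[x y] l] [u [w [v [t [/= [Au Sw] Bv Et ->]]]]] x0 y0 /=.
  have s0 := nrm_gt0 x0; have q0 := nrm_gt0 y0.
  have hbe : nrm (inner y w / (nrm x * nrm y)%:C) ^+ 2 <= C * (rip u x / nrm x ^+ 2 + m).
    have h1 : nrm (inner y w / (nrm x * nrm y)%:C) <= nrm w / nrm x.
      rewrite nrmM nrmV nrm_real gtr0_norm ?mulr_gt0//.
      rewrite ler_pdivrMr ?mulr_gt0// mulrA divfK ?gt_eqF// mulrC.
      exact: cauchy_schwarz.
    apply: le_trans (sqr_le_sqr (nrm_ge0 _) h1) _.
    rewrite exprMn exprVn ler_pdivrMr ?exprn_gt0//.
    have -> : C * (rip u x / nrm x ^+ 2 + m) * nrm x ^+ 2 =
        C * (rip u x + m * nrm x ^+ 2) by field; rewrite gt_eqF.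
    rewrite -(qaE Au); apply: adjB_le Sw.
    by exists u.
  have [De0 hDe] := hK _ _ _ hbe (fun la => sep _ _ _ _ _ la Au Sw Et x0 y0).
  apply: qnr_lower => //.
  - exact: self_adjoint_real self_A Au.
  - exact: self_adjoint_real self_E Et.
  - exact: (Sw _ _ Bv).
move=> p Tp.
have [[[A0 AP] _] _ _] := self_A; have [[B0 BP] _] := op_B.
have [[[E0 EP] _] _ _] := self_E; have [S0 SP] := adjoint_subspace B.
have [x0 [u0 [w0 [y0 [v0 [t0 [nx ny [Au Sw] [Bv Et]]]]]]]] := sym_block_nontrivial.
have [b hb] := perturb p.1.1 nx; have [b' hb'] := perturb p.1.2 ny.
pose h : H1 * H2 := (b%:R *: x0, b'%:R *: y0).
pose l : H1 * H2 := (b%:R *: u0 + b'%:R *: v0, b%:R *: w0 + b'%:R *: t0).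
have Tq : sym_block A B E (h, l).
  exists (b%:R *: u0), (b%:R *: w0), (b'%:R *: v0), (b'%:R *: t0); split => //=.
  - by split; have := @AP b%:R _ _ Au A0; have := @SP b%:R _ _ Sw S0; rewrite !addr0.
  - by have := @BP b'%:R _ _ Bv B0; rewrite addr0.
  - by have := @EP b'%:R _ _ Et E0; rewrite addr0.
pose g (r : (H1 * H2) * (H1 * H2)) := (r.2.1, - r.2.2) - z *: r.1.
apply: (@le_small _ _ _ (2 * K * nrm (g (h, l)) + nrm h)) => e e0.
have Te : sym_block A B E (e%:C *: (h, l) + p).
  by apply: (sym_block_subspace self_A op_B self_E).2.
have ge : g (e%:C *: (h, l) + p) = e%:C *: g (h, l) + g p.
  have gE (H : hilbertType R) (x y x' y' : H) :
      e%:C *: x + y - z *: (e%:C *: x' + y') = e%:C *: (x - z *: x') + (y - z *: y').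
    by rewrite !scalerDr scalerN opprD !scalerA [z * _]mulrC addrACA.
  rewrite /g; congr pair; first exact: gE.
  rewrite -[RHS]gE; congr (_ - _); apply: etrans (opprD _ _) _.
  by congr (_ - _); rewrite scalerN.
have he : (e%:C *: (h, l) + p).1 = p.1 + e%:C *: h by rewrite addrC.
have := generic _ Te.
rewrite -/(g _) ge he => /(_ (hb _ e0) (hb' _ e0)) h1.
have h2 : nrm p.1 <= nrm (p.1 + e%:C *: h) + e * nrm h.
  rewrite -{1}(addrK (e%:C *: h) p.1); apply: le_trans (nrmB _ _) _.
  by rewrite nrmZ nrm_real gtr0_norm.
have h3 : nrm (e%:C *: g (h, l) + g p) <= e * nrm (g (h, l)) + nrm (g p).
  by apply: le_trans (nrmD _ _) _; rewrite nrmZ nrm_real gtr0_norm.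
have h4 := ler_wpM2l K20 h3.
by move: h1 h2 h4; rewrite -/(g p); clear; lra.
Qed.

End LowerBound.

(** * The involution J and the resolvent set of J N *)

Section Flip.
Context {R : realType} {H1 H2 : hilbertType R}.

Definition flip (p : H1 * H2) : H1 * H2 := (p.1, - p.2).

(** This is J N: since J is an involution, l = J N h means J l = N h. *)
Definition flip_op (N : set ((H1 * H2) * (H1 * H2))) : set ((H1 * H2) * (H1 * H2)) :=
  [set p | N (p.1, flip p.2)].

Lemma flipK : involutive flip.
Proof. by case=> x y; rewrite /flip /= opprK. Qed.

Lemma flipZ c p : flip (c *: p) = c *: flip p.
Proof. by rewrite /flip /=; congr pair; rewrite /= scalerN. Qed.

Lemma flipD p q : flip (p + q) = flip p + flip q.
Proof. by rewrite /flip /=; congr pair; rewrite /= opprD. Qed.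

Lemma nrm_flip p : nrm (flip p) = nrm p.
Proof. by rewrite !nrm_pair /= nrmN. Qed.

Lemma rip_flip p q : pip (flip p) q = pip p (flip q).
Proof.
by rewrite /pip /= (ripNl (@rip_inner _ H2)) (ripNr (@rip_inner _ H2)).
Qed.

Lemma pipZ (c : R[i]) (p q : H1 * H2) : pip (c *: p) q = pip p (conjc c *: q).
Proof. by rewrite /pip /rip /= !innerZl !innerZr conjcK. Qed.

Lemma flip_op_subspace N : is_subspace N -> is_subspace (flip_op N).
Proof.
move=> [N0 NP]; split; first by rewrite /flip_op /flip /= oppr0.
move=> c p q hp hq; rewrite /flip_op /= flipD flipZ.
exact: (NP c _ _ hp hq).
Qed.

Lemma closure_flip N h l : closure N (h, l) -> closure (flip_op N) (h, flip l).
Proof.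
move=> /closure_nrmP hN; apply/closure_nrmP => e /hN[[h' l'] [Nh]].
rewrite nrm_pair_lt /= => /andP[e1 e2]; exists (h', flip l'); split.
  by rewrite /flip_op /= flipK.
rewrite nrm_pair_lt /= e1 /=.
by rewrite -scaleN1r -flipZ -flipD nrm_flip scaleN1r.
Qed.

(* With J = flip, the symmetric operator N is essentially self-adjoint because
   the range of N - mu is dense; hence (J N)^* = N J, and the orthogonal
   complement of the range of J N - z is J ker (J N - conj z). *)
Lemma flip_resolvent (N : set ((H1 * H2) * (H1 * H2))) (mu K K' : R) (z : R[i]) :
  is_subspace N ->
  (forall p q, N p -> N q -> pip p.2 q.1 = pip p.1 q.2) ->
  (forall w, exists h, closure N (h, w + mu%:C *: h)) ->
  (forall k, (forall h l, N (h, l) -> pip (l - mu%:C *: h) k = 0) -> k = 0) ->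
  0 <= K -> 0 <= K' ->
  (forall h l, flip_op N (h, l) -> nrm h <= K * nrm (l - z *: h)) ->
  (forall h l, flip_op N (h, l) -> nrm h <= K' * nrm (l - conjc z *: h)) ->
  resolvent_set (closure (flip_op N)) z.
Proof.
move=> sN symN surjN orthN K0 K'0 lowz lowJ.
have hp := @pip_inner _ H1 H2.
apply: (@resolvent_criterion _ _ _ hp _ _ K) => //.
- by apply: prod_complete; exact: hilbert_complete.
- exact: flip_op_subspace.
move=> k hk.
(* J k is expected in the domain of the closure of N with value conj z k. So h0 solves (N - mu) h0 =
   conj z k - mu J k in the closure, and h0 = J k remains to be shown. *)
have [h0 Nh0] := surjN (conjc z *: k - mu%:C *: flip k).
have kh : flip k - h0 = 0.
  apply: orthN => h l Nhl.
  have := hk h (flip l); rewrite /flip_op /= flipK => /(_ Nhl).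
  have := closure_symmetric symN Nhl Nh0 => /=.
  rewrite !(ripBl hp, ripDr hp, ripBr hp, ripNr hp) !(ripZl hp) !(ripZr hp).
  by rewrite rip_flip (pipZ z) => e1 e2; lra.
have {}kh : flip k = h0 := subr0_eq kh.
(* The closure of J N now maps J k to conj z J k, and the second lower bound forces J k = 0. *)
rewrite -kh subrK in Nh0.
have := closure_lower_bound K'0 lowJ (closure_flip Nh0).
rewrite flipZ subrr nrm0 mulr0 => /nrm_le0 /(congr1 flip).
by rewrite flipK => ->; rewrite /flip /= oppr0.
Qed.

End Flip.

(** * The operator matrix as J N *)

Section BlockOp.
Context {R : realType}.

Lemma appE (U V : normedModType R[i]) (T : set (U * V)) x u :
  is_operator T -> T (x, u) -> app T x = u.
Proof.
move=> [_ oT] Txu; apply: (oT x) => //; rewrite /app.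
exact: (@xgetPex _ 0 [set u | T (x, u)] (ex_intro _ u Txu)).
Qed.

Lemma appP (U V : normedModType R[i]) (T : set (U * V)) x :
  dom T x -> T (x, app T x).
Proof. by move=> [u Txu]; exact: (@xgetPex _ 0 [set u | T (x, u)] (ex_intro _ u Txu)). Qed.

Lemma opp_operator (U V : normedModType R[i]) (T : set (U * V)) :
  is_operator T -> is_operator (opp_op T).
Proof.
move=> [[T0 TP] oT]; split; last by move=> x u v h1 h2; apply: oppr_inj; apply: oT h1 h2.
split; first by rewrite /opp_op /= oppr0.
move=> c p q h1 h2; rewrite /opp_op /= opprD -scalerN.
exact: (TP c _ _ h1 h2).
Qed.

(** Both entries of the second row, -B^* and D = -E, carry the sign that J puts there. *)
Lemma block_opE (H1 H2 : hilbertType R) (A : set (H1 * H1)) (B : set (H2 * H1))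
    (D : set (H2 * H2)) :
  is_operator A -> is_operator B -> is_operator (adjoint B) -> is_operator D ->
  block_op A B (opp_op (adjoint B)) D = flip_op (sym_block A B (opp_op D)).
Proof.
move=> oA oB oS oD; apply/seteqP; split=> -[[x y] [f g]].
  move=> [[/appP Ax /appP Sx] [/appP By /appP Dy] /= [-> ->]].
  exists (app A x), (- app (opp_op (adjoint B)) x), (app B y), (- app D y).
  by split => //=; [rewrite /opp_op /= opprK|rewrite /flip /= opprD].
move=> [u [w [v [t [/= [Au Sw] Bv Et [-> gE]]]]]].
have Sw' : opp_op (adjoint B) (x, - w) by rewrite /opp_op /= opprK.
split => /=.
- by split; [exists u|exists (- w)].
- by split; [exists v|exists (- t)].
rewrite (appE oA Au) (appE oB Bv) (appE (opp_operator oS) Sw') (appE oD Et).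
by rewrite -(opprK g) gE opprD.
Qed.

End BlockOp.

(** * Spectral inclusion, by contraposition *)

Theorem proposition4p12 (R : realType) (H1 H2 : hilbertType R)
    (A : set (H1 * H1)) (B : set (H2 * H1)) (D : set (H2 * H2))
    (a : sesq_form H1) (d : sesq_form H2) (delta : R) (z : R[i])
    (hA : self_adjoint A) (hA_below : bounded_from_below A)
    (hB : is_operator B) (hB_dense : densely_defined B)
    (hB_closable : closable B)
    (hD : self_adjoint D) (hD_above : bounded_from_above D)
    (ha : is_form_of A a) (hd : is_form_of_above D d)
    (haB : form_dom a `<=` dom (adjoint B))
    (hBD : is_core (dom B) D \/ form_dom d `<=` dom B)
    (hdelta : is_max [set r : R | spectrum D r%:C] delta)
    (hz : ~ exists r : R,
        delta < r < delta + relative_bound a (adjoint B) /\ z = r%:C) :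
  spectrum (closure (block_op A B (opp_op (adjoint B)) D)) z ->
  closure (quadratic_numerical_range a d (adjoint B)) z.
Proof.
move=> specz; apply: contrapT => nclz; apply: specz.
have oS := adjoint_operator hB_dense.
have [oA dA adjA] := hA; have [oD _ _] := hD.
rewrite block_opE//; set E := opp_op D.
have hE : self_adjoint E := opp_self_adjoint hD.
have [sym_a low_a closed_a _ aE] := ha.
have [[[d0 _] _ _] _ _ _ dE] := hd.
(* The defining property of the form, applied with y = 0, places dom A in its domain. *)
have domAa x u : A (x, u) -> form_dom a x.
  move=> Au; have [[a0 _] _ _] := sym_a.
  by have [] := aE _ _ _ Au a0.
have domEd y t : E (y, t) -> form_dom d y.
  by move=> Et; have [] := dE _ _ _ Et d0.
have [m [C [C1 qa_ge adjB_le]]] :=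
  form_relative_bound sym_a low_a closed_a hB.1 hB_dense haB.
have [c lowA] := hA_below; have [cE lowE] := hD_above.
pose qa (x : H1) := complex.Re (a x x).
have qaE x u : A (x, u) -> qa x = rip u x.
  by move=> Au; rewrite /qa; have [_ ->] := aE _ _ _ Au (domAa _ _ Au).
have dom_A : dom A `<=` dom (adjoint B).
  by move=> x [u /domAa]; exact: haB.
(* In case (II) dom D lies in dom d, hence in dom B, and the restricted graph is all of E; in case
   (I) the core property of D is transported through the sign. *)
have core_E p : E p -> closure [set p | E p /\ dom B p.1] p.
  move: p => [y t] Et; case: hBD => [[_ coreD]|domd]; last first.
    by apply: subset_closure; split => //; apply: domd; exact: domEd Et.
  have : closure [set p | D p /\ dom B p.1] (y, - t) by rewrite coreD.
  move=> /closure_nrmP h; apply/closure_nrmP => e /h[[y' t'] [[Dy By]]].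
  rewrite nrm_pair_lt /= => /andP[e1 e2]; exists (y', - t'); split.
    by split => //; rewrite /E /opp_op /= opprK.
  by rewrite nrm_pair_lt /= e1 -nrmN opprD opprK.
have [ep ep0 sep] : exists2 ep : R, 0 < ep & qnr_separated A B E z ep.
  have [ep [ep0 hep]] : exists ep : R, 0 < ep /\
      forall la, quadratic_numerical_range a d (adjoint B) la -> ep <= nrm (z - la).
    apply: contrapT => nep; apply: nclz; apply/closure_nrmP => e e0.
    apply: contrapT => ne; apply: nep; exists e; split => // la hla.
    by rewrite leNgt; apply/negP => lt_e; apply: ne; exists la.
  exists ep => // x u w y t la Au Sw Et x0 y0 root_la.
  rewrite nrmC; apply: hep; exists x, y.
  have ax := domAa _ _ Au; have dy := domEd _ _ Et.
  split=> //; have := qnr_root_eigenvalue root_la.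
  have [_ axx] := aE _ _ _ Au ax; have [_ /= dyy] := dE _ _ _ Et dy.
  have bJ : inner w y / (`|x| * `|y|) = conjc (inner y w / (nrm x * nrm y)%:C).
    have cM (p q : R[i]) : conjc (p * q) = conjc p * conjc q := rmorphM _ p q.
    have cV (p : R[i]) : conjc p^-1 = (conjc p)^-1 := fmorphV _ p.
    by rewrite cM cV realcJ -innerC !nrmE -rmorphM.
  rewrite /block_form_mx (appE oS Sw) bJ axx -[d y y]opprK dyy.
  rewrite (self_adjoint_real hA Au) (self_adjoint_real hE Et) !nrmE.
  have divC (p q : R) : (p / q ^+ 2)%:C = p%:C / q%:C ^+ 2.
    by rewrite rmorphM fmorphV rmorphXn.
  have oppC (p : R) : (- p)%:C = - p%:C := rmorphN _ p.
  have mulC (p q : R) : (p * q)%:C = p%:C * q%:C := rmorphM _ p q.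
  by rewrite !divC oppC mulC.
have adjB_le' x w : dom A x -> adjoint B (x, w) -> nrm w ^+ 2 <= C * (qa x + m * nrm x ^+ 2).
  by move=> [u /domAa ax]; exact: adjB_le.
have qa_ge' x : dom A x -> nrm x ^+ 2 <= qa x + m * nrm x ^+ 2.
  by move=> [u /domAa ax]; exact: qa_ge.
have [K K0 lowK] :=
  sym_block_lower_separated hA hB hE dom_A core_E C1 qaE adjB_le' ep0 sep.
have [K' K'0 lowK'] :=
  sym_block_lower_separated hA hB hE dom_A core_E C1 qaE adjB_le' ep0 (qnr_separatedJ sep).
(* The first two bounds make N - mu >= 1; the third puts mu below the lower bound c of A. *)
pose mu := Num.min (- m - 1) (Num.min (cE - C - 1) (c - 1)).
have mu1 : mu <= - m - 1 by rewrite ge_min lexx.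
have mu2 : mu <= cE - C - 1 by rewrite !ge_min lexx orbT.
have muc : mu < c.
  by apply: (@le_lt_trans _ _ (c - 1)); [rewrite !ge_min lexx !orbT|lra].
have sN := sym_block_subspace hA hB hE.
have orthN := sym_block_trivial_orthogonal hA hB hE dom_A C1 qaE adjB_le' lowE
  core_E mu1 mu2 (ex_intro2 _ _ _ lowA muc).
have lowN := sym_block_lower C1 qaE qa_ge' adjB_le' lowE mu1 mu2.
have [surjN _] : resolvent_set (closure (sym_block A B E)) mu%:C.
  apply: (@resolvent_criterion _ _ _ (@pip_inner _ H1 H2) _ _ 2) => //.
  by apply: prod_complete; exact: hilbert_complete.
apply: (@flip_resolvent _ _ _ _ mu K K') => //.
- exact: (sym_block_symmetric hA hE).
- by move=> w; have [h [Nh _]] := surjN w; exists h.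
- by move=> h l /lowK /=; rewrite opprK -surjective_pairing.
- by move=> h l /lowK' /=; rewrite opprK -surjective_pairing.
Qed.
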